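(* Consider the mean-shift model $y=X\beta^\star+\mu^\star+\varepsilon$ with $X\in\mathbb{R}^{n\times p}$ deterministic with columns of unit Euclidean norm, $|\beta^\star|_0\le k$ and $|\mu^\star|_0\le s$ for positive integers $k,s$, and $\varepsilon\sim\mathcal N(0,\sigma^2I_n)$. Let $\lambda_i=\sigma\sqrt{\log(2n/i)}$ for $i=1,\dots,n$, $\tilde\lambda_j=\sigma\sqrt{\log(2p/j)}$ for $j=1,\dots,p$, let $\rho\ge2(4+\sqrt2)$, and let $$(\hat\beta,\hat\mu)\in\arg\min_{\beta\in\mathbb{R}^p,\mu\in\mathbb{R}^n}\Big\{\|y-X\beta-\mu\|_2^2+2\rho J_{\tilde\lambda}(\beta)+2\rho J_\lambda(\mu)\Big\}.$$ Let $k_1=k\log(2ep/k)/\log2$ and $s_1=s\log(2en/s)/\log2$, and suppose there are constants $\kappa_1>2\kappa_2>0$ such that for all $(\beta,\mu)\in\mathbb{R}^p\times\mathbb{R}^n$ satisfying $$\sum_{j=1}^p\frac{\tilde\lambda_j}{\tilde\lambda_p}|\beta|_{(j)}+\sum_{j=1}^n\frac{\lambda_j}{\lambda_n}|\mu|_{(j)}\le5\big(\sqrt{k_1}\|\beta\|_2+\sqrt{s_1}\|\mu\|_2\big)$$ one has $\|X\beta\|_2^2+\|\mu\|_2^2\ge\kappa_1(\|\beta\|_2^2+\|\mu\|_2^2)$ and $|\langle X\beta,\mu\rangle|\le\kappa_2(\|\beta\|_2^2+\|\mu\|_2^2)$. Let $\kappa=\sqrt{\kappa_1-2\kappa_2}$.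 Then there is a constant $C'>0$ depending only on $\rho$ such that, with probability at least $1-\frac12(s/2n)^s-\frac12(k/2p)^k$, $$\|\hat\beta-\beta^\star\|_2^2+\|\hat\mu-\mu^\star\|_2^2\le\frac{C'}{\kappa^4}\Big(\sum_{j=1}^k\tilde\lambda_j^2+\sum_{j=1}^s\lambda_j^2\Big)\le\frac{C'\sigma^2}{\kappa^4}\Big(k\log\Big(\frac{2ep}{k}\Big)+s\log\Big(\frac{2en}{s}\Big)\Big).$$
   Context: For $u\in\mathbb{R}^m$, $|u|_0$ is the number of nonzero entries of $u$, and $|u|_{(1)}\ge\dots\ge|u|_{(m)}$ are the absolute values of its entries sorted in non-increasing order. For a vector $\lambda\in\mathbb{R}^m$ with non-negative non-increasing entries, the sorted-$\ell_1$ norm is $J_\lambda(x)=\sum_{j=1}^m\lambda_j|x|_{(j)}$. *)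

(* Defs.v *)
From HB Require Import structures.
From mathcomp Require Import all_boot all_order all_algebra.
From mathcomp Require Import all_classical all_reals all_analysis.
Set Implicit Arguments. Unset Strict Implicit. Unset Printing Implicit Defensive.
Import Order.TTheory GRing.Theory Num.Theory.
Local Open Scope classical_set_scope.
Local Open Scope ring_scope.

Section Defs.
Variable R : realType.

Definition l0 {m} (u : 'cV[R]_m) : nat := #|[set i : 'I_m | u i 0 != 0]|.

Definition sqn {m} (u : 'cV[R]_m) : R := \sum_(i < m) u i 0 ^+ 2.
Definition l2 {m} (u : 'cV[R]_m) : R := Num.sqrt (sqn u).
Definition dotv {m} (u v : 'cV[R]_m) : R := \sum_(i < m) u i 0 * v i 0.

(* |u|_(1) >= ... >= |u|_(m): absolute values sorted non-increasingly;
   sorted_abs u j is |u|_(j+1) (0-based index j) *)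
Definition sorted_abs {m} (u : 'cV[R]_m) (j : nat) : R :=
  nth 0 (sort (fun a b : R => b <= a) [seq `|u i 0| | i <- enum 'I_m]) j.

(* sorted-l1 norm J_lam(x) = sum_{j=1}^m lam_j |x|_(j), with lam given
   1-based as a function on nat *)
Definition Jsl {m} (lam : nat -> R) (u : 'cV[R]_m) : R :=
  \sum_(j < m) lam j.+1 * sorted_abs u j.

Definition lamw (sigma : R) (m : nat) (i : nat) : R :=
  sigma * Num.sqrt (ln (2 * m%:R / i%:R)).

Definition indep_rvs d (T : measurableType d) (P : probability T R) m
  (e : 'I_m -> T -> R) : Prop :=
  forall A : 'I_m -> set R, (forall i, measurable (A i)) ->
    P (\bigcap_(i in [set: 'I_m]) (e i @^-1` A i)) =
    (\prod_(i < m) P (e i @^-1` A i))%E.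

End Defs.

(* Main.v *)
Require Import Defs.
From HB Require Import structures.
From mathcomp Require Import all_boot all_order all_algebra.
From mathcomp Require Import all_classical all_reals all_analysis.
From mathcomp Require Import measurable_realfun fingroup perm zify ring lra.
Import Order.TTheory GRing.Theory Num.Theory.
Local Open Scope classical_set_scope.
Local Open Scope ring_scope.
Set Implicit Arguments. Unset Strict Implicit. Unset Printing Implicit Defensive.

(** Noise: with J(u, v) the total penalty of u and v, one event carries
      <eps, X u + v> <= 32/5 J(u, v) + tau |X u + v|   for all u and v,
    where tau^2 is of order sigma^2 min(k log(2p/k), s log(2n/s)).  With
    probability at least 1/2 the bound 3 J(u, v) holds, by Markov's inequality
    for sums of exp(3 g^2 / (8 sigma^2)).  The other term comes from Gaussian
    concentration of suprema of linear forms, obtained by the Maurey-Pisier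
    rotation argument with only three rotations by pi/6; their second-order
    error is absorbed in the exponential moment, so no limit is needed, but the
    constant in front of the median doubles: whence 32/5 > 2 * 3.

    Using the joint direction X u + v in the noise bound, instead of X u and v
    separately, is what makes it compatible with the left-hand side
    |X u + v|^2 of the basic inequality.  Off the cone of the restricted
    eigenvalue condition, J(u, v) > 5 (A |u| + B |v|) with A and B the norms of
    the leading weights, and as 32/5 < 3 rho/5 the penalty itself is then at
    most of order tau^2, hence |u| + |v| is of order tau.  On the cone the
    restricted eigenvalue condition applies directly. *)

(** * Norms of column vectors *)

Section sum_cauchy_schwarz.
Context {R : rcfType} {I : finType}.

Lemma sum_mul_sqr_le (a b : I -> R) :
  (\sum_i a i * b i) ^+ 2 <= (\sum_i a i ^+ 2) * (\sum_i b i ^+ 2).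
Proof.
suff : 0 <= 2 * ((\sum_i a i ^+ 2) * (\sum_i b i ^+ 2) - (\sum_i a i * b i) ^+ 2) by lra.
rewrite (_ : _ * _ = \sum_i \sum_j (a i * b j - a j * b i) ^+ 2).
  by rewrite sumr_ge0// => i _; rewrite sumr_ge0// => j _; exact: sqr_ge0.
have inner_sum i : \sum_j (a i * b j - a j * b i) ^+ 2 =
    a i ^+ 2 * (\sum_j b j ^+ 2) + b i ^+ 2 * (\sum_j a j ^+ 2) -
    a i * b i * (2 * \sum_j a j * b j).
  by rewrite !mulr_sumr -big_split -sumrB; apply: eq_bigr => j _ /=; ring.
by rewrite (eq_bigr _ (fun i _ => inner_sum i)) sumrB big_split/= -!mulr_suml; ring.
Qed.

Lemma sum_mul_le_sqrt (a b : I -> R) :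
  \sum_i a i * b i <= Num.sqrt (\sum_i a i ^+ 2) * Num.sqrt (\sum_i b i ^+ 2).
Proof.
have sum_sqr_ge0 (f : I -> R) : 0 <= \sum_i f i ^+ 2.
  by rewrite sumr_ge0// => i _; exact: sqr_ge0.
rewrite (le_trans (ler_norm _))// -sqrtr_sqr -sqrtrM//.
by rewrite ler_sqrt ?sum_mul_sqr_le// mulr_ge0.
Qed.

End sum_cauchy_schwarz.

Section vector_norms.
Context {R : realType}.

Definition l1 m (u : 'cV[R]_m) : R := \sum_(i < m) `|u i 0|.

Lemma l1_ge0 m (u : 'cV[R]_m) : 0 <= l1 u. Proof. exact: sumr_ge0. Qed.

Lemma l2_ge0 m (u : 'cV[R]_m) : 0 <= l2 u. Proof. exact: sqrtr_ge0. Qed.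

Lemma sqn_ge0 m (u : 'cV[R]_m) : 0 <= sqn u.
Proof. by rewrite sumr_ge0// => i _; exact: sqr_ge0. Qed.

Lemma sqr_l2 m (u : 'cV[R]_m) : l2 u ^+ 2 = sqn u.
Proof. by rewrite sqr_sqrtr// sqn_ge0. Qed.

Lemma dotvDl m (u v w : 'cV[R]_m) : dotv (u + v) w = dotv u w + dotv v w.
Proof. by rewrite /dotv -big_split/=; apply: eq_bigr => i _; rewrite mxE mulrDl. Qed.

Lemma dotvC m (u v : 'cV[R]_m) : dotv u v = dotv v u.
Proof. by apply: eq_bigr => i _; rewrite mulrC. Qed.

Lemma dotvZr m a (u v : 'cV[R]_m) : dotv u (a *: v) = a * dotv u v.
Proof. by rewrite /dotv mulr_sumr; apply: eq_bigr => i _; rewrite mxE mulrCA. Qed.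

Lemma dotvv m (u : 'cV[R]_m) : dotv u u = sqn u.
Proof. by apply: eq_bigr => i _; rewrite expr2. Qed.

Lemma dotv_le_l2 m (u v : 'cV[R]_m) : dotv u v <= l2 u * l2 v.
Proof. exact: sum_mul_le_sqrt. Qed.

Lemma sqn0 m : sqn (0 : 'cV[R]_m) = 0.
Proof. by rewrite /sqn big1// => i _; rewrite mxE expr0n. Qed.

Lemma sqnZ m a (u : 'cV[R]_m) : sqn (a *: u) = a ^+ 2 * sqn u.
Proof. by rewrite /sqn mulr_sumr; apply: eq_bigr => i _; rewrite mxE exprMn. Qed.

Lemma sqnD m (u v : 'cV[R]_m) : sqn (u + v) = sqn u + 2 * dotv u v + sqn v.
Proof.
rewrite /sqn /dotv mulr_sumr -!big_split/=; apply: eq_bigr => i _.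
by rewrite mxE; ring.
Qed.

Lemma sqn_delta m (i : 'I_m) : sqn (delta_mx i 0 : 'cV[R]_m) = 1.
Proof.
rewrite /sqn (bigD1 i)//= mxE !eqxx expr1n big1 ?addr0// => j /negbTE ji.
by rewrite mxE ji expr0n.
Qed.

Lemma l2_0 m : l2 (0 : 'cV[R]_m) = 0. Proof. by rewrite /l2 sqn0 sqrtr0. Qed.

Lemma l2_delta m (i : 'I_m) : l2 (delta_mx i 0 : 'cV[R]_m) = 1.
Proof. by rewrite /l2 sqn_delta sqrtr1. Qed.

Lemma l1_0 m : l1 (0 : 'cV[R]_m) = 0.
Proof. by rewrite /l1 big1// => i _; rewrite mxE normr0. Qed.

Lemma l1_delta m (i : 'I_m) : l1 (delta_mx i 0 : 'cV[R]_m) = 1.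
Proof.
rewrite /l1 (bigD1 i)//= mxE !eqxx normr1 big1 ?addr0// => j /negbTE ji.
by rewrite mxE ji normr0.
Qed.

Lemma l2_eq0 m (u : 'cV[R]_m) : l2 u = 0 -> u = 0.
Proof.
move=> u0; have /psumr_eq0P sqr0 : sqn u = 0 by rewrite -sqr_l2 u0 expr0n.
apply/colP => i; rewrite mxE; apply/eqP; rewrite -sqrf_eq0.
by rewrite sqr0// => j _; exact: sqr_ge0.
Qed.

Lemma l2_triangle m (u v : 'cV[R]_m) : l2 (u + v) <= l2 u + l2 v.
Proof.
rewrite -(@ler_pXn2r _ 2)// ?nnegrE ?addr_ge0 ?l2_ge0//.
by rewrite sqrrD !sqr_l2 sqnD; have := dotv_le_l2 u v; lra.
Qed.

Lemma l2_le_l1 m (u : 'cV[R]_m) : l2 u <= l1 u.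
Proof.
rewrite -(@ler_pXn2r _ 2)// ?nnegrE ?l2_ge0 ?l1_ge0// sqr_l2.
rewrite /sqn expr2 mulr_suml; apply: ler_sum => i _.
rewrite -real_normK ?num_real// expr2 ler_wpM2l// /l1 (bigD1 i)//= lerDl.
exact: sumr_ge0.
Qed.

Lemma l1_mulmx n m (M : 'M[R]_(n, m)) (u : 'cV[R]_m) :
  l1 (M *m u) <= (\sum_(i < n) \sum_(j < m) `|M i j|) * l1 u.
Proof.
rewrite mulr_suml; apply: ler_sum => i _.
rewrite mxE (le_trans (ler_norm_sum _ _ _))// mulr_suml; apply: ler_sum => j _.
rewrite normrM ler_wpM2l// /l1 (bigD1 j)//= lerDl; exact: sumr_ge0.
Qed.

Definition rat_vec m (k : nat) : 'cV[R]_m :=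
  map_mx ratr (odflt 0 (unpickle k : option 'cV[rat]_m)).

Lemma rat_vec_dense m (u : 'cV[R]_m) (e : R) : 0 < e ->
  exists k, l1 (rat_vec m k - u) <= m%:R * e.
Proof.
move=> e0.
have approx (x : R) : {r : rat | `|ratr r - x| <= e}.
  apply: cid; have xe : x - e < x + e by lra.
  have [r] := rat_in_itvoo xe; rewrite in_itv/= => /andP[rl ru].
  by exists r; rewrite ler_norml; apply/andP; split; lra.
exists (pickle (\col_j sval (approx (u j 0)))); rewrite /rat_vec pickleK /l1.
rewrite mulr_natl -[in leRHS](card_ord m) -sumr_const; apply: ler_sum => j _.
by rewrite !mxE; case: (approx _).
Qed.

Lemma ge0_of_rat_vec m (f : 'cV[R]_m -> R) (C : R) : 0 <= C ->
  (forall u v, f v <= f u + C * l1 (v - u)) ->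
  (forall k, 0 <= f (rat_vec m k)) -> forall u, 0 <= f u.
Proof.
move=> C0 f_lip f0 u; rewrite leNgt; apply/negP => fu0.
pose D := C * m%:R + 1.
have D0 : 0 < D by rewrite ltr_wpDl// mulr_ge0.
have [k ku] : exists k, l1 (rat_vec m k - u) <= m%:R * (- f u / D).
  by apply: rat_vec_dense; rewrite divr_gt0// oppr_gt0.
have : C * l1 (rat_vec m k - u) < - f u.
  apply: (le_lt_trans (ler_wpM2l C0 ku)); rewrite !mulrA ltr_pdivrMr//.
  by rewrite mulrC ltr_pM2l ?oppr_gt0// ltrDl.
by have := f0 k; have := f_lip u (rat_vec m k); lra.
Qed.

End vector_norms.

(** * Gaussian measures on the line and the plane *)

Section lebesgue_plane.
Context {R : realType}.
Local Open Scope ereal_scope.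
Notation leb := (@lebesgue_measure R).

Let measurable_shift (a : R) :
  measurable_fun [set: measurableTypeR R] (+%R^~ a : _ -> measurableTypeR R).
Proof. exact: (@measurable_funD _ R R setT id (cst a)). Qed.

Lemma lebesgue_measure_shift (a : R) (A : set R) : measurable A ->
  pushforward leb (+%R^~ a : _ -> measurableTypeR R) A = leb A.
Proof.
move=> mA; apply/esym/lebesgue_measure_unique => // _ [[b c] /= _ <-].
rewrite /pushforward /= (_ : _ @^-1` _ = `](b - a)%R, (c - a)%R]%classic); last first.
  by apply/seteqP; split => x /=; rewrite !in_itv/= ltrBlDr lerBrDr.
rewrite !lebesgue_measure_itv/= !lte_fin ltrD2r; case: ifP => // _.
by rewrite -!EFinB opprB addrA subrK.
Qed.

Lemma ge0_integral_shift (a : R) (f : R -> \bar R) :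
  measurable_fun setT f -> (forall x, 0 <= f x) ->
  \int[leb]_x f (x + a)%R = \int[leb]_x f x.
Proof.
move=> mf f0; rewrite -[X in integral _ X](preimage_setT (+%R^~ a)).
rewrite -(ge0_integral_pushforward (measurable_shift a))//.
by apply: eq_measure_integral => A mA _; exact: lebesgue_measure_shift.
Qed.

Lemma ge0_integral_shear_snd (a : R) (G : R * R -> \bar R) :
  measurable_fun setT G -> (forall z, 0 <= G z) ->
  \int[leb]_x \int[leb]_y G (x, y + a * x)%R = \int[leb]_x \int[leb]_y G (x, y).
Proof.
move=> mG G0; apply: eq_integral => x _.
rewrite (ge0_integral_shift (a * x) (f := fun y => G (x, y)))//.
exact: measurable_fun_pair2.
Qed.

Let measurable_shear_fst (a : R) :
  measurable_fun setT (fun z : R * R => (z.1 + a * z.2, z.2)%R).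
Proof.
by apply: measurable_fun_pair => //; apply: measurable_funD => //; apply: measurable_funM.
Qed.

Let measurable_shear_snd (a : R) :
  measurable_fun setT (fun z : R * R => (z.1, z.2 + a * z.1)%R).
Proof.
by apply: measurable_fun_pair => //; apply: measurable_funD => //; apply: measurable_funM.
Qed.

Lemma ge0_integral_shear_fst (a : R) (G : R * R -> \bar R) :
  measurable_fun setT G -> (forall z, 0 <= G z) ->
  \int[leb]_x \int[leb]_y G (x + a * y, y)%R = \int[leb]_x \int[leb]_y G (x, y).
Proof.
move=> mG G0.
transitivity (\int[leb]_y \int[leb]_x G (x + a * y, y)%R).
  apply: (@fubini_tonelli _ _ _ _ R leb leb (fun z : R * R => G (z.1 + a * z.2, z.2)%R)) => //.
  exact: (measurableT_comp mG (measurable_shear_fst a)).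
transitivity (\int[leb]_y \int[leb]_x G (x, y)); last first.
  by apply/esym; exact: (@fubini_tonelli _ _ _ _ R leb leb G).
apply: eq_integral => y _.
rewrite (ge0_integral_shift (a * y) (f := fun x => G (x, y)))//.
exact: measurable_fun_pair1.
Qed.

(* The rotation is a product of three shears. *)
Lemma ge0_integral_rotation (c s : R) (G : R * R -> \bar R) :
  (c ^+ 2 + s ^+ 2 = 1)%R -> (s != 0)%R ->
  measurable_fun setT G -> (forall z, 0 <= G z) ->
  \int[leb]_x \int[leb]_y G (c * x + s * y, - s * x + c * y)%R =
  \int[leb]_x \int[leb]_y G (x, y).
Proof.
move=> cs s0 mG G0; pose t : R := ((1 - c) / s)%R.
have ts : (t * s = 1 - c)%R by rewrite /t divfK.
have tc : (t * (1 + c) = s)%R.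
  apply: (mulIf s0); rewrite mulrAC ts -expr2 (_ : s ^+ 2 = 1 - c ^+ 2)%R; first by ring.
  by rewrite -cs addrC addKr.
pose G1 (z : R * R) := G (z.1 + t * z.2, z.2)%R.
have mG1 : measurable_fun setT G1 by exact: (measurableT_comp mG (measurable_shear_fst t)).
pose G2 (z : R * R) := G1 (z.1, z.2 + - s * z.1)%R.
have mG2 : measurable_fun setT G2 by exact: (measurableT_comp mG1 (measurable_shear_snd (- s))).
transitivity (\int[leb]_x \int[leb]_y G2 (x + t * y, y)%R); last first.
  rewrite (ge0_integral_shear_fst t mG2 (fun z => G0 _)).
  rewrite (ge0_integral_shear_snd (- s) mG1 (fun z => G0 _)).
  exact: ge0_integral_shear_fst.
apply: eq_integral => x _; apply: eq_integral => y _; congr (G (_, _)) => /=.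
- transitivity (x * (1 - t * s) + y * (t * (2 - t * s)))%R; last by ring.
  by rewrite ts (_ : 2 - (1 - c) = 1 + c)%R ?tc; ring.
- transitivity (- s * x + y * (1 - t * s))%R; last by ring.
  by rewrite ts; ring.
Qed.

End lebesgue_plane.

Lemma measurable_expR_EFin {R : realType} d (T : measurableType d) (f : T -> R) :
  measurable_fun setT f -> measurable_fun setT (fun x => (expR (f x))%:E).
Proof. by move=> mf; apply/measurable_EFinP; exact: measurableT_comp. Qed.

Section normal_distribution.
Context {R : realType}.
Local Open Scope ereal_scope.
Notation leb := (@lebesgue_measure R).

Lemma measurable_normal_pdf_EFin (m sigma : R) :
  measurable_fun setT (fun x => (normal_pdf m sigma x)%:E).
Proof. by apply/measurable_EFinP; exact: measurable_normal_pdf. Qed.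

Lemma ge0_integral_normal_prob (m sigma : R) (f : R -> \bar R) :
  measurable_fun setT f -> (forall x, 0 <= f x) ->
  \int[normal_prob m sigma]_x f x =
  \int[leb]_x (f x * (normal_pdf m sigma x)%:E).
Proof.
move=> mf f0; have dom := normal_prob_dominates m sigma.
rewrite -(Radon_Nikodym_SigmaFinite.change_of_variables dom)//.
have mpdf := measurable_normal_pdf_EFin m sigma.
apply: ae_eq_integral => //.
- apply: emeasurable_funM => //.
  exact: (measurable_int _ (Radon_Nikodym_SigmaFinite.f_integrable dom)).
- exact: emeasurable_funM.
- apply: ae_eqe_mul2l; apply: integral_ae_eq => //=.
  + exact: Radon_Nikodym_SigmaFinite.f_integrable.
  + by move=> E _ mE; rewrite -Radon_Nikodym_SigmaFinite.f_integral.
Qed.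

Lemma ge0_integral2_normal_prob (m1 m2 sigma1 sigma2 : R) (F : R * R -> \bar R) :
  measurable_fun setT F -> (forall z, 0 <= F z) ->
  \int[normal_prob m1 sigma1]_x \int[normal_prob m2 sigma2]_y F (x, y) =
  \int[leb]_x \int[leb]_y
    (F (x, y) * (normal_pdf m2 sigma2 y * normal_pdf m1 sigma1 x)%:E).
Proof.
move=> mF F0; rewrite ge0_integral_normal_prob//; last 2 first.
- exact: (@measurable_fun_fubini_tonelli_F _ _ _ _ R (normal_prob m2 sigma2) F).
- by move=> x; exact: integral_ge0.
apply: eq_integral => x _.
have mFx := measurable_fun_pair2 x mF.
rewrite ge0_integral_normal_prob// -ge0_integralZr//.
- by apply: eq_integral => y _; rewrite EFinM muleA.
- by apply: emeasurable_funM => //; exact: measurable_normal_pdf_EFin.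
- by move=> y _; rewrite mule_ge0// lee_fin normal_pdf_ge0.
- by rewrite lee_fin normal_pdf_ge0.
Qed.

Lemma integral_normal_prob_pdfZ (m m' sigma sigma' c : R) (f : R -> R) : (0 <= c)%R ->
  measurable_fun setT f -> (forall x, 0 <= f x)%R ->
  (forall x, f x * normal_pdf m sigma x = c * normal_pdf m' sigma' x)%R ->
  \int[normal_prob m sigma]_x (f x)%:E = c%:E.
Proof.
move=> c0 mf f0 fE; rewrite ge0_integral_normal_prob//; last exact/measurable_EFinP.
under eq_integral do rewrite -EFinM fE EFinM.
rewrite ge0_integralZl// ?integral_normal_pdf ?mule1//.
- exact: measurable_normal_pdf_EFin.
- by move=> x _; rewrite lee_fin normal_pdf_ge0.
Qed.

Lemma normal_mgf (m sigma a : R) : (sigma != 0)%R ->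
  \int[normal_prob m sigma]_x (expR (a * x))%:E =
  (expR (a * m + a ^+ 2 * sigma ^+ 2 / 2))%:E.
Proof.
move=> s0; apply: (@integral_normal_prob_pdfZ _ (m + a * sigma ^+ 2) _ sigma).
- exact: expR_ge0.
- by apply: measurableT_comp => //; exact: measurable_funM.
- by move=> x; exact: expR_ge0.
move=> x; rewrite !normal_pdfE// /normal_fun !(mulrCA _ (normal_peak _)) -!expRD.
by congr (_ * expR _)%R; field.
Qed.

Lemma normal_peakM (r sigma : R) : (0 <= r)%R ->
  normal_peak (r * sigma) = (r^-1 * normal_peak sigma)%R.
Proof.
move=> r0; rewrite /normal_peak exprMn -mulrA -mulrnAr sqrtrM ?sqr_ge0//.
by rewrite sqrtr_sqr ger0_norm// invfM.
Qed.

Lemma normal_expR_sqr (sigma a : R) : (sigma != 0)%R -> (2 * a * sigma ^+ 2 < 1)%R ->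
  \int[normal_prob 0 sigma]_x (expR (a * x ^+ 2))%:E =
  (Num.sqrt (1 - 2 * a * sigma ^+ 2))^-1%:E.
Proof.
move=> s0 a1; set r := Num.sqrt _.
have r_gt0 : (0 < r)%R by rewrite sqrtr_gt0 subr_gt0.
have r0 : (r != 0)%R by exact: lt0r_neq0.
have r2 : (r ^+ 2 = 1 - 2 * a * sigma ^+ 2)%R by rewrite sqr_sqrtr// subr_ge0 ltW.
apply: (@integral_normal_prob_pdfZ _ 0%R _ (r^-1 * sigma)).
- by rewrite invr_ge0 ltW.
- by apply: measurableT_comp => //; apply: measurable_funM => //; exact: measurable_funX.
- by move=> x; exact: expR_ge0.
move=> x; rewrite !normal_pdfE ?mulf_neq0 ?invr_eq0// /normal_fun.
rewrite normal_peakM ?invr_ge0 ?ltW// invrK -(mulrA r) mulKf//.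
rewrite (mulrCA _ (normal_peak _)) -expRD; congr (_ * expR _)%R.
rewrite exprMn exprVn r2; field.
by rewrite s0 -r2 expf_neq0.
Qed.

Lemma normal_pdf_rotation (sigma c s x y : R) : (sigma != 0)%R ->
  (c ^+ 2 + s ^+ 2 = 1)%R ->
  (normal_pdf 0 sigma (- s * x + c * y) * normal_pdf 0 sigma (c * x + s * y) =
   normal_pdf 0 sigma y * normal_pdf 0 sigma x)%R.
Proof.
move=> s0 cs; rewrite !normal_pdfE// /normal_fun mulrACA [RHS]mulrACA -!expRD.
congr (_ * _)%R; congr expR; rewrite -!mulrDl; congr (_ / _)%R.
transitivity (- (c ^+ 2 + s ^+ 2) * (x ^+ 2 + y ^+ 2))%R; first by ring.
by rewrite cs; ring.
Qed.

Lemma normal_rotation (sigma c s : R) (F : R * R -> \bar R) : (sigma != 0)%R ->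
  (c ^+ 2 + s ^+ 2 = 1)%R -> (s != 0)%R ->
  measurable_fun setT F -> (forall z, 0 <= F z) ->
  \int[normal_prob 0 sigma]_x \int[normal_prob 0 sigma]_y
    F (c * x + s * y, - s * x + c * y)%R =
  \int[normal_prob 0 sigma]_x \int[normal_prob 0 sigma]_y F (x, y).
Proof.
move=> sigma0 cs s0 mF F0.
have mrot : measurable_fun setT
    (fun z : R * R => (c * z.1 + s * z.2, - s * z.1 + c * z.2)%R).
  by apply: measurable_fun_pair; apply: measurable_funD; exact: measurable_funM.
rewrite (ge0_integral2_normal_prob _ _ _ _ (measurableT_comp mF mrot)); last first.
  by move=> z /=.
rewrite (ge0_integral2_normal_prob _ _ _ _ mF F0).
pose H (z : R * R) := F z * (normal_pdf 0 sigma z.2 * normal_pdf 0 sigma z.1)%:E.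
rewrite -[RHS](ge0_integral_rotation cs s0 (G := H)).
- apply: eq_integral => x _; apply: eq_integral => y _.
  by rewrite /H /= normal_pdf_rotation.
- apply: emeasurable_funM => //; apply/measurable_EFinP; apply: measurable_funM.
  + exact: (measurableT_comp (measurable_normal_pdf 0 sigma)).
  + exact: (measurableT_comp (measurable_normal_pdf 0 sigma)).
- by move=> z; rewrite mule_ge0// lee_fin mulr_ge0// normal_pdf_ge0.
Qed.

End normal_distribution.

(** * Finite powers of a probability measure *)

Lemma measurable_fun_integral2 {R : realType} d0 d1 d2 (T0 : measurableType d0)
    (T1 : measurableType d1) (T2 : measurableType d2)
    (m1 : {sigma_finite_measure set T1 -> \bar R})
    (m2 : {sigma_finite_measure set T2 -> \bar R})
    (F : T0 * (T1 * T2) -> \bar R) :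
  measurable_fun setT F -> (forall z, 0 <= F z)%E ->
  measurable_fun setT (fun z => \int[m1]_x \int[m2]_y F (z, (x, y)))%E.
Proof.
move=> mF F0.
apply: (measurable_fun_fubini_tonelli_F (fun q => \int[m2]_y F (q.1, (q.2, y)))%E).
  apply: (measurable_fun_fubini_tonelli_F
    (fun r : (T0 * T1) * T2 => F (r.1.1, (r.1.2, r.2)))) => //.
  apply: (measurableT_comp mF); apply: measurable_fun_pair; first exact: measurableT_comp.
  by apply: measurable_fun_pair => //; exact: measurableT_comp.
by move=> q; apply: integral_ge0 => y _; exact: F0.
Qed.

Section iid_prob.
Context {R : realType} {d : measure_display} {S : measurableType d}.
Variable mu : probability S R.
Local Open Scope ereal_scope.

Definition tcons n (z : S * n.-tuple S) : n.+1.-tuple S := [tuple of z.1 :: z.2].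

Lemma measurable_tcons n : measurable_fun setT (@tcons n).
Proof. exact: measurable_cons. Qed.

HB.instance Definition _ n :=
  isMeasurableFun.Build _ _ _ _ (@tcons n) (@measurable_tcons n).

Lemma tnth_tconsS n (z : S * n.-tuple S) i : tnth (tcons z) (lift ord0 i) = tnth z.2 i.
Proof. by rewrite /tcons /= tnthS. Qed.

Fixpoint iid_prob n : probability (n.-tuple S) R :=
  if n is m.+1 then distribution (mu \x iid_prob m) (@tcons m) else dirac [tuple].

Lemma integral_iid_prob0 (f : 0.-tuple S -> \bar R) :
  measurable_fun setT f -> \int[iid_prob 0]_t f t = f [tuple].
Proof. by move=> mf; rewrite integral_dirac// diracT mul1e. Qed.

Lemma integral_iid_probS n (f : n.+1.-tuple S -> \bar R) :
  measurable_fun setT f -> (forall t, 0 <= f t) ->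
  \int[iid_prob n.+1]_t f t = \int[mu]_x \int[iid_prob n]_t f (tcons (x, t)).
Proof.
move=> mf f0; rewrite /= ge0_integral_distribution//.
rewrite (fubini_tonelli1 (f \o @tcons n))//; last by move=> x /=.
exact: (measurableT_comp mf (@measurable_tcons n)).
Qed.

Lemma integral2_iid_probS n (F : n.+1.-tuple S * n.+1.-tuple S -> \bar R) :
  measurable_fun setT F -> (forall z, 0 <= F z) ->
  \int[iid_prob n.+1]_x \int[iid_prob n.+1]_y F (x, y) =
  \int[mu]_a \int[mu]_b \int[iid_prob n]_x \int[iid_prob n]_y
    F (tcons (a, x), tcons (b, y)).
Proof.
move=> mF F0; rewrite integral_iid_probS; last 2 first.
- exact: (measurable_fun_fubini_tonelli_F F).
- by move=> x; exact: integral_ge0.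
apply: eq_integral => a _.
transitivity (\int[iid_prob n]_x \int[mu]_b \int[iid_prob n]_y
    F (tcons (a, x), tcons (b, y))).
  by apply: eq_integral => x _; rewrite integral_iid_probS//; exact: measurable_fun_pair2.
pose H (q : (n.-tuple S * S) * n.-tuple S) := F (tcons (a, q.1.1), tcons (q.1.2, q.2)).
have mH : measurable_fun setT H.
  apply: measurableT_comp => //; apply: measurable_fun_pair.
    apply: (measurableT_comp (@measurable_tcons n)); apply: measurable_fun_pair => //.
    exact: measurableT_comp.
  apply: (measurableT_comp (@measurable_tcons n)); apply: measurable_fun_pair => //.
  exact: measurableT_comp.
apply: (@fubini_tonelli _ _ _ _ R (iid_prob n) mu (fun z => \int[iid_prob n]_y H (z, y))).
- by apply: measurable_fun_fubini_tonelli_F => // q; exact: F0.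
- by move=> z; apply: integral_ge0 => y _; exact: F0.
Qed.

Lemma measurable_tuple_box n (A : 'I_n -> set S) : (forall i, measurable (A i)) ->
  measurable [set t : n.-tuple S | forall i, A i (tnth t i)].
Proof.
move=> mA.
rewrite (_ : [set t | _] = \big[setI/setT]_(i < n) ((fun t => tnth t i) @^-1` A i)).
  apply: bigsetI_measurable => i _; rewrite -[X in measurable X]setTI.
  exact: (measurable_tnth i).
rewrite -bigcap_seq/=; apply/seteqP; split => t /= tA i; first by move=> _; exact: tA.
by apply: (tA i); rewrite /= mem_index_enum.
Qed.

Lemma iid_prob_box n (A : 'I_n -> set S) : (forall i, measurable (A i)) ->
  iid_prob n [set t | forall i, A i (tnth t i)] = \prod_(i < n) mu (A i).
Proof.
elim: n A => [|n IH] A mA; first by rewrite big_ord0 /= diracE mem_set//= => -[].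
rewrite big_ord_recl /= /distribution /pushforward.
pose A' i := A (lift ord0 i).
rewrite (_ : _ @^-1` _ = A ord0 `*` [set t : n.-tuple S | forall i, A' i (tnth t i)]).
  rewrite product_measure1E//; last exact: (@measurable_tuple_box n A' (fun i => mA _)).
  by congr (_ * _); exact: (IH A' (fun i => mA _)).
apply/seteqP; split => -[x t] /=.
  move=> xtA; split; first exact: (xtA ord0).
  by move=> i; have := xtA (lift ord0 i); rewrite tnth_tconsS.
move=> [xA tA] i; case: (unliftP ord0 i) => [j ->|-> //].
by rewrite tnth_tconsS; exact: tA.
Qed.

End iid_prob.

Lemma eq_probability_tuple {R : realType} d (S : measurableType d) n
    (P Q : probability (n.-tuple S) R) :
  (forall A : 'I_n -> set S, (forall i, measurable (A i)) ->
     P [set t | forall i, A i (tnth t i)] = Q [set t | forall i, A i (tnth t i)]) ->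
  forall B, measurable B -> P B = Q B.
Proof.
move=> PQ B mB.
pose boxes : set (set (n.-tuple S)) := [set C | exists2 A : 'I_n -> set S,
  forall i, measurable (A i) & C = [set t | forall i, A i (tnth t i)]].
apply: (measure_unique boxes (fun=> setT)) => //.
- apply/seteqP; split.
    apply: sub_sigma_algebra2; rewrite -bigcup_seq => C [i _ [D mD <-]].
    exists (fun j => if j == i then D else setT); first by move=> j; case: ifP.
    apply/seteqP; split => t /=; first by move=> [_ Dt] j; case: eqP => [->|].
    by move=> /(_ i); rewrite eqxx.
  move=> C; rewrite /measurable/=; apply: smallest_sub; first exact: sigma_algebra_measurable.
  by move=> _ [A mA ->]; exact: measurable_tuple_box.
- move=> _ _ [A mA ->] [A' mA' ->]; exists (fun i => A i `&` A' i).
    by move=> i; exact: measurableI.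
  apply/seteqP; split => t /=; first by move=> [tA tA'] i; split.
  by move=> tAA'; split => i; case: (tAA' i).
- by move=> _; exists (fun=> setT) => //; apply/seteqP.
- by rewrite bigcup_const.
- by move=> _ [A mA ->]; exact: PQ.
- by move=> _; rewrite (le_lt_trans (probability_le1 _ _))// ltry.
Qed.

(** * Gaussian vectors *)

Section tuple_forms.
Context {R : realType}.
Notation RR := (measurableTypeR R).

Definition tdot n (w : 'cV[R]_n) (x : n.-tuple RR) : R :=
  \sum_(i < n) w i 0 * (tnth x i : R).

Definition tcomb n (a b : R) (x y : n.-tuple RR) : n.-tuple RR :=
  [tuple (a * (tnth x i : R) + b * (tnth y i : R) : RR) | i < n].

Definition trot n (c s : R) (z : n.-tuple RR * n.-tuple RR) : n.-tuple RR * n.-tuple RR :=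
  (tcomb c s z.1 z.2, tcomb (- s) c z.1 z.2).

Lemma tdot0 n (x : n.-tuple RR) : tdot 0 x = 0.
Proof. by rewrite /tdot big1// => i _; rewrite mxE mul0r. Qed.

Lemma tdotD n (v w : 'cV[R]_n) x : tdot (v + w) x = tdot v x + tdot w x.
Proof. by rewrite /tdot -big_split/=; apply: eq_bigr => i _; rewrite mxE mulrDl. Qed.

Lemma tdotZ n a (w : 'cV[R]_n) x : tdot (a *: w) x = a * tdot w x.
Proof. by rewrite /tdot mulr_sumr; apply: eq_bigr => i _; rewrite mxE mulrA. Qed.

Lemma tdot_ge_l1 n (w : 'cV[R]_n) (x : n.-tuple RR) :
  - tdot w x <= (\sum_(i < n) `|tnth x i : R|) * l1 w.
Proof.
rewrite (le_trans (ler_norm _))// normrN (le_trans (ler_norm_sum _ _ _))// mulr_suml.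
apply: ler_sum => i _; rewrite normrM mulrC ler_wpM2l// /l1 (bigD1 i)//= lerDl.
exact: sumr_ge0.
Qed.

Lemma tdot_tcons n (w : 'cV[R]_n.+1) (x : RR) (t : n.-tuple RR) :
  tdot w (tcons (x, t)) = w ord0 0 * (x : R) + tdot (\col_i w (lift ord0 i) 0) t.
Proof.
rewrite /tdot big_ord_recl; congr (_ + _).
by apply: eq_bigr => i _; rewrite tnth_tconsS mxE.
Qed.

Lemma tdot_tcomb n (w : 'cV[R]_n) a b x y :
  tdot w (tcomb a b x y) = a * tdot w x + b * tdot w y.
Proof.
rewrite /tdot !mulr_sumr -big_split/=; apply: eq_bigr => i _.
by rewrite tnth_mktuple; ring.
Qed.

Lemma tcomb01 n (x y : n.-tuple RR) : tcomb 0 1 x y = y.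
Proof. by apply: eq_from_tnth => i; rewrite tnth_mktuple mul0r add0r mul1r. Qed.

Lemma tcomb10 n (x y : n.-tuple RR) : tcomb 1 0 x y = x.
Proof. by apply: eq_from_tnth => i; rewrite tnth_mktuple mul0r addr0 mul1r. Qed.

Lemma tcomb_tcons n a b (x y : RR) (t u : n.-tuple RR) :
  tcomb a b (tcons (x, t)) (tcons (y, u)) =
  tcons ((a * (x : R) + b * (y : R))%R : RR, tcomb a b t u).
Proof.
apply: eq_from_tnth => i; rewrite tnth_mktuple.
by case: (unliftP ord0 i) => [j ->|-> //]; rewrite !tnth_tconsS/= tnth_mktuple.
Qed.

Lemma measurable_tdot d (T : measurableType d) n (w : T -> 'cV[R]_n) (x : T -> n.-tuple RR) :
  (forall i, measurable_fun setT (fun t => w t i 0)) -> measurable_fun setT x ->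
  measurable_fun setT (fun t => tdot (w t) (x t)).
Proof.
move=> mw mx; apply: measurable_sum => i; apply: measurable_funM => //.
exact: (measurableT_comp (measurable_tnth i) mx).
Qed.

Lemma measurable_tdotr n (w : 'cV[R]_n) : measurable_fun setT (tdot w).
Proof. exact: measurable_tdot. Qed.

Lemma measurable_tcomb n (a b : R) :
  measurable_fun setT (fun z : n.-tuple RR * n.-tuple RR => tcomb a b z.1 z.2).
Proof.
apply/measurable_fun_tnthP => i /=.
rewrite (_ : _ \o _ = fun z : n.-tuple RR * n.-tuple RR =>
  (a * (tnth z.1 i : R) + b * (tnth z.2 i : R))); last first.
  by apply/funext => z /=; rewrite tnth_mktuple.
apply: measurable_funD; apply: measurable_funM => //.
- exact: (measurableT_comp (measurable_tnth i) measurable_fst).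
- exact: (measurableT_comp (measurable_tnth i) measurable_snd).
Qed.

Lemma measurable_trot n (c s : R) : measurable_fun setT (@trot n c s).
Proof. by apply: measurable_fun_pair; exact: measurable_tcomb. Qed.

End tuple_forms.

Section gauss_prob.
Context {R : realType}.
Notation RR := (measurableTypeR R).
Local Open Scope ereal_scope.

Definition gauss_prob (sigma : R) n : probability (n.-tuple RR) R :=
  iid_prob (normal_prob 0 sigma : probability RR R) n.

Variable sigma : R.
Hypothesis sigma_neq0 : (sigma != 0)%R.

Lemma gauss_mgf n (w : 'cV[R]_n) :
  \int[gauss_prob sigma n]_x (expR (tdot w x))%:E =
  (expR (sigma ^+ 2 / 2 * sqn w))%:E.
Proof.
have mexp m (v : 'cV[R]_m) : measurable_fun setT (fun x => (expR (tdot v x))%:E).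
  by apply: measurable_expR_EFin; exact: measurable_tdotr.
elim: n w => [|n IH] w.
  by rewrite integral_iid_prob0// /tdot /sqn !big_ord0 mulr0.
pose v := (\col_i w (lift ord0 i) 0)%R.
rewrite integral_iid_probS//.
transitivity (\int[normal_prob 0 sigma]_x
    ((expR (w ord0 0 * x))%:E * (expR (sigma ^+ 2 / 2 * sqn v))%:E)).
  apply: eq_integral => x _.
  under eq_integral do rewrite tdot_tcons expRD EFinM.
  by rewrite ge0_integralZl//; [congr (_ * _); exact: IH|exact: mexp].
rewrite ge0_integralZr//; last first.
  by apply: measurable_expR_EFin; exact: measurable_funM.
rewrite normal_mgf// -EFinM -expRD /sqn big_ord_recl; congr (expR _)%:E.
by under eq_bigr do rewrite mxE; field.
Qed.

(* The square is linearised by integrating out an independent N(0, 1). *)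
Lemma gauss_expR_sqr n (w : 'cV[R]_n) (a : R) : (0 <= a)%R ->
  (2 * a * sigma ^+ 2 * sqn w < 1)%R ->
  \int[gauss_prob sigma n]_x (expR (a * tdot w x ^+ 2))%:E =
  (Num.sqrt (1 - 2 * a * sigma ^+ 2 * sqn w))^-1%:E.
Proof.
move=> a0 a1; pose h : probability RR R := normal_prob 0 1.
pose r : R := Num.sqrt (2 * a).
have r2 : (r ^+ 2 = 2 * a)%R by rewrite sqr_sqrtr// mulr_ge0.
pose F (q : n.-tuple RR * RR) := (expR (r * tdot w q.1 * (q.2 : R)))%:E.
have mF : measurable_fun setT F.
  apply: measurable_expR_EFin; apply: measurable_funM.
    apply: measurable_funM => //.
    exact: (measurableT_comp (measurable_tdotr w) measurable_fst).
  exact: (@measurable_snd _ _ (n.-tuple RR) RR).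
have F0 q : 0 <= F q by rewrite lee_fin expR_ge0.
transitivity (\int[gauss_prob sigma n]_x \int[h]_z F (x, z)).
  apply: eq_integral => x _; rewrite /F/= normal_mgf ?oner_eq0//; congr (expR _)%:E.
  by rewrite mulr0 add0r expr1n mulr1 exprMn r2; field.
rewrite (fubini_tonelli F)//.
pose b := (a * sigma ^+ 2 * sqn w)%R.
transitivity (\int[h]_z (expR (b * (z : R) ^+ 2))%:E).
  apply: eq_integral => z _; rewrite /F /=.
  under eq_integral do rewrite mulrAC -tdotZ.
  rewrite gauss_mgf; congr (expR _)%:E; rewrite /sqn.
  under eq_bigr do rewrite mxE exprMn.
  by rewrite -mulr_sumr -/(sqn w) exprMn r2 /b; field.
have bE : (2 * b * 1 ^+ 2 = 2 * a * sigma ^+ 2 * sqn w)%R by rewrite /b; ring.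
by rewrite normal_expR_sqr ?oner_eq0 ?bE.
Qed.

Lemma gauss_rotation n (c s : R) (F : n.-tuple RR * n.-tuple RR -> \bar R) :
  (c ^+ 2 + s ^+ 2 = 1)%R -> (s != 0)%R ->
  measurable_fun setT F -> (forall z, 0 <= F z) ->
  \int[gauss_prob sigma n]_x \int[gauss_prob sigma n]_y F (trot c s (x, y)) =
  \int[gauss_prob sigma n]_x \int[gauss_prob sigma n]_y F (x, y).
Proof.
move=> cs s0; elim: n F => [|n IH] F mF F0.
  apply: eq_integral => x _; apply: eq_integral => y _.
  by congr (F (_, _)); apply: eq_from_tnth => -[].
pose Fcons (a b : RR) (z : n.-tuple RR * n.-tuple RR) := F (tcons (a, z.1), tcons (b, z.2)).
have mFcons : measurable_fun setT
    (fun q : (RR * RR) * (n.-tuple RR * n.-tuple RR) => Fcons q.1.1 q.1.2 q.2).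
  apply: measurableT_comp => //; apply: measurable_fun_pair;
    apply: (measurableT_comp (@measurable_tcons _ _ n));
    by apply: measurable_fun_pair; exact: measurableT_comp.
pose H (z : RR * RR) :=
  \int[gauss_prob sigma n]_x \int[gauss_prob sigma n]_y Fcons z.1 z.2 (x, y).
rewrite (integral2_iid_probS _ (measurableT_comp mF (@measurable_trot _ n.+1 c s)) (fun z => F0 _)).
rewrite (integral2_iid_probS _ mF F0).
transitivity (\int[normal_prob 0 sigma]_a \int[normal_prob 0 sigma]_b
    H (c * a + s * b, - s * a + c * b)%R).
  apply: eq_integral => a _; apply: eq_integral => b _.
  pose ab := (c * a + s * b, - s * a + c * b)%R.
  transitivity (\int[gauss_prob sigma n]_x \int[gauss_prob sigma n]_y
      Fcons ab.1 ab.2 (trot c s (x, y))).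
    apply: eq_integral => x _; apply: eq_integral => y _.
    by rewrite /trot /Fcons /= !tcomb_tcons.
  apply: IH => [|z]; last exact: F0.
  exact: (measurable_fun_pair2 (ab : RR * RR) mFcons).
apply: normal_rotation => //.
- apply: (measurable_fun_integral2 _ _ (F := fun q => Fcons q.1.1 q.1.2 q.2)) => // q.
  exact: F0.
- by move=> z; apply: integral_ge0 => x _; apply: integral_ge0 => y _; exact: F0.
Qed.

End gauss_prob.

(** * Concentration of suprema of Gaussian linear forms *)

Lemma measurable_set_le {R : realType} d (T : measurableType d) (f g : T -> R) :
  measurable_fun setT f -> measurable_fun setT g -> measurable [set x | f x <= g x].
Proof.
move=> mf mg; rewrite -[X in measurable X]setTI.
by have /(_ measurableT [set true]) := measurable_fun_ler mf mg; exact.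
Qed.

Section probability_moments.
Context {R : realType} d (T : measurableType d) (P : probability T R).
Variable f : T -> R.
Hypothesis mf : measurable_fun setT f.
Local Open Scope ereal_scope.

Lemma integral_cst_probability (r : R) : \int[P]_x r%:E = r%:E.
Proof. by rewrite integral_cst// -[RHS]mule1; congr (_ * _); exact: probability_setT. Qed.

Lemma integral_le_sqrt_moment2 (m : R) : (forall x, 0 <= f x)%R ->
  \int[P]_x (f x ^+ 2)%:E = m%:E -> \int[P]_x (f x)%:E <= (Num.sqrt m)%:E.
Proof.
move=> f0 fm.
have m0 : (0 <= m)%R.
  by rewrite -lee_fin -fm; apply: integral_ge0 => x _; rewrite lee_fin sqr_ge0.
have conj_exponents : (2^-1 + 2^-1 = 1 :> R)%R by lra.
have := hoelder P mf (measurable_cst (1 : R)%R) (ltr0n _ 2) (ltr0n _ 2) conj_exponents.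
have -> : 'N[P]_2%:E[EFin \o cst 1%R] = 1.
  by rewrite Lnorm_cst1 -[RHS](poweR1r 2^-1); congr (_ `^ _); exact: probability_setT.
rewrite mule1 Lnorm1 unlock => holder_le.
rewrite -(powR12_sqrt m0) -poweR_EFin -fm.
move: holder_le; under eq_integral do rewrite /= mulr1 ger0_norm//.
by under [X in _ <= X `^ _ -> _]eq_integral do rewrite /= ger0_norm// powR_mulrn//.
Qed.

Lemma mgf_opp_ge (th a q : R) : (0 <= th)%R -> q%:E <= P [set x | (f x <= a)%R] ->
  (q * expR (- (th * a)))%:E <= \int[P]_x (expR (- th * f x))%:E.
Proof.
move=> th0 qP.
have mE : measurable [set x | (f x <= a)%R] by exact: measurable_set_le.
have mexp : measurable_fun setT (fun x => (expR (- th * f x))%:E).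
  by apply: measurable_expR_EFin; exact: measurable_funM.
apply: (@le_trans _ _ (\int[P]_(x in [set x | (f x <= a)%R]) (expR (- (th * a)))%:E)).
  by rewrite integral_cst// muleC EFinM; exact: lee_wpmul2r.
apply: (@le_trans _ _ (\int[P]_(x in [set x | (f x <= a)%R]) (expR (- th * f x))%:E)).
  apply: ge0_le_integral => //=; first exact: measurable_funTS.
  by move=> x fxa; rewrite lee_fin ler_expR mulNr lerN2 ler_wpM2l.
exact: ge0_subset_integral.
Qed.

Lemma mgf_diff_ge (th a q : R) : (0 <= th)%R -> q%:E <= P [set x | (f x <= a)%R] ->
  (q * expR (- (th * a)))%:E * \int[P]_x (expR (th * f x))%:E <=
  \int[P]_x \int[P]_y (expR (th * (f y - f x)))%:E.
Proof.
move=> th0 qP.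
have mexp b : measurable_fun setT (fun x => (expR (b * f x))%:E).
  by apply: measurable_expR_EFin; exact: measurable_funM.
have -> : \int[P]_x \int[P]_y (expR (th * (f y - f x)))%:E =
    \int[P]_x ((expR (- th * f x))%:E * \int[P]_y (expR (th * f y))%:E).
  apply: eq_integral => x _; rewrite -ge0_integralZl//.
  by apply: eq_integral => y _; rewrite -EFinM -expRD mulNr -mulrN -mulrDr addrC.
rewrite ge0_integralZr//; last exact: integral_ge0.
by apply: lee_wpmul2r; [exact: integral_ge0|exact: mgf_opp_ge].
Qed.

End probability_moments.

Lemma mul3_le_mean_cube {R : realFieldType} (a b c : R) : 0 <= a -> 0 <= b -> 0 <= c ->
  a * b * c <= (a ^+ 3 + b ^+ 3 + c ^+ 3) / 3.
Proof.
move=> a0 b0 c0; rewrite ler_pdivlMr// -subr_ge0.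
rewrite (_ : _ - _ = (a + b + c) * ((a - b) ^+ 2 + (b - c) ^+ 2 + (a - c) ^+ 2) / 2).
  by rewrite divr_ge0// mulr_ge0// ?addr_ge0// ?sqr_ge0.
by field.
Qed.

Section three_term_average.
Context {R : realType}.

Lemma expR_sum3_le (a b c : R) :
  expR (a + b + c) <= 3^-1 * (expR (3 * a) + expR (3 * b) + expR (3 * c)).
Proof.
rewrite !expRD !expRM_natl [leRHS]mulrC.
by apply: mul3_le_mean_cube; exact: expR_ge0.
Qed.

Local Open Scope ereal_scope.

Lemma ge0_le_integral2_mean3 d1 d2 (T1 : measurableType d1) (T2 : measurableType d2)
    (P : probability T1 R) (Q : probability T2 R) (F F1 F2 F3 : T1 * T2 -> \bar R) I :
  measurable_fun setT F -> (forall z, 0 <= F z) ->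
  measurable_fun setT F1 -> (forall z, 0 <= F1 z) ->
  measurable_fun setT F2 -> (forall z, 0 <= F2 z) ->
  measurable_fun setT F3 -> (forall z, 0 <= F3 z) ->
  (forall z, F z <= 3^-1%:E * (F1 z + F2 z + F3 z)) ->
  \int[P]_x \int[Q]_y F1 (x, y) = I -> \int[P]_x \int[Q]_y F2 (x, y) = I ->
  \int[P]_x \int[Q]_y F3 (x, y) = I ->
  \int[P]_x \int[Q]_y F (x, y) <= I.
Proof.
move=> mF F0 mF1 F10 mF2 F20 mF3 F30 FF I1 I2 I3.
have F120 z : 0 <= F1 z + F2 z by rewrite adde_ge0.
have mF12 : measurable_fun setT (fun z => F1 z + F2 z) by exact: emeasurable_funD.
have F1230 z : 0 <= F1 z + F2 z + F3 z by rewrite adde_ge0.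
have mF123 : measurable_fun setT (fun z => F1 z + F2 z + F3 z) by exact: emeasurable_funD.
rewrite -(fubini_tonelli1 F)//.
apply: (@le_trans _ _ (\int[P \x Q]_z (3^-1%:E * (F1 z + F2 z + F3 z)))).
  by apply: ge0_le_integral => //=; exact: emeasurable_funM.
rewrite ge0_integralZl// ge0_integralD// ge0_integralD//.
rewrite (fubini_tonelli1 F1)// (fubini_tonelli1 F2)// (fubini_tonelli1 F3)//.
rewrite /fubini_F I1 I2 I3.
have : 0 <= I by rewrite -I1; apply: integral_ge0 => x _; exact: integral_ge0.
case: I {I1 I2 I3} => [r| |] // r0; last by rewrite !addye// mulry gtr0_sg// mul1e.
by rewrite -!EFinD -EFinM lee_fin; lra.
Qed.

End three_term_average.

Section maxdot.
Context {R : realType}.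
Variables (n : nat) (w : nat -> 'cV[R]_n).
Notation RR := (measurableTypeR R).
Implicit Types x y : n.-tuple RR.

Fixpoint maximizer N x : 'cV[R]_n :=
  if N is M.+1 then
    if tdot (maximizer M x) x <= tdot (w M) x then w M else maximizer M x
  else 0.

Definition maxdot N x := tdot (maximizer N x) x.

Lemma maximizer_ind (Q : 'cV[R]_n -> Prop) N x :
  Q 0 -> (forall k, (k < N)%N -> Q (w k)) -> Q (maximizer N x).
Proof.
move=> Q0; elim: N => [//|N IH] Qw /=; case: ifP => _; first exact: Qw.
by apply: IH => k kN; apply: Qw; rewrite ltnS ltnW.
Qed.

Lemma maxdot_ge N x k : (k < N)%N -> tdot (w k) x <= maxdot N x.
Proof.
rewrite /maxdot; elim: N => [//|N IH] /=; rewrite ltnS leq_eqVlt => /predU1P[->|kN].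
  by case: ifP => // /negbT; rewrite -ltNge => /ltW.
by case: ifP => le_max; rewrite ?(le_trans (IH kN)).
Qed.

Lemma maxdot_ge0 N x : 0 <= maxdot N x.
Proof.
rewrite /maxdot; elim: N => [|N IH] /=; first by rewrite tdot0.
by case: ifP => //; exact: le_trans.
Qed.

Lemma maxdot_le N x a : 0 <= a -> (forall k, (k < N)%N -> tdot (w k) x <= a) ->
  maxdot N x <= a.
Proof.
by move=> a0 wa; apply: (maximizer_ind (Q := fun v => tdot v x <= a)) => //; rewrite tdot0.
Qed.

Lemma tdot_maximizer_le N x y : tdot (maximizer N x) y <= maxdot N y.
Proof.
apply: (maximizer_ind (Q := fun v => tdot v y <= maxdot N y)) => [|k kN].
- by rewrite tdot0 maxdot_ge0.
- exact: maxdot_ge.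
Qed.

Lemma maxdot_nondecreasing x : nondecreasing_seq (maxdot^~ x).
Proof.
move=> M N MN; apply: maxdot_le => [|k kM]; first exact: maxdot_ge0.
by apply: maxdot_ge; exact: leq_trans MN.
Qed.

Lemma measurable_maximizer N i : measurable_fun setT (fun x => maximizer N x i 0).
Proof.
elim: N i => [|N IH] i /=; first exact: measurable_cst.
rewrite (_ : (fun x => _) = (fun x => if tdot (maximizer N x) x <= tdot (w N) x
  then w N i 0 else maximizer N x i 0)); last by apply/funext => x; case: ifP.
apply: measurable_fun_ifT => //.
by apply: measurable_fun_ler; exact: measurable_tdot.
Qed.

Lemma measurable_maxdot N : measurable_fun setT (maxdot N).
Proof. by apply: measurable_tdot => // i; exact: measurable_maximizer. Qed.

HB.instance Definition _ N :=
  isMeasurableFun.Build _ _ _ _ (maxdot N) (measurable_maxdot N).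

(* [maximizer N x] is a subgradient of the convex function [maxdot N] at [x]. *)
Lemma maxdot_sub_le N (c s : R) x x' z :
  (forall v, tdot v z = c * tdot v x - s * tdot v x') ->
  maxdot N x - maxdot N z <= (1 - c) * maxdot N x + s * tdot (maximizer N x) x'.
Proof. by move=> zE; have := tdot_maximizer_le N x z; rewrite zE -/(maxdot N x); lra. Qed.

Definition trot_increment N (c s : R) (z : n.-tuple RR * n.-tuple RR) : R :=
  (1 - c) * maxdot N z.1 + s * tdot (maximizer N z.1) z.2.

Lemma measurable_trot_increment N c s : measurable_fun setT (trot_increment N c s).
Proof.
apply: measurable_funD; apply: measurable_funM => //.
  exact: (measurableT_comp (measurable_maxdot N) measurable_fst).
apply: measurable_tdot => // i.
exact: (measurableT_comp (measurable_maximizer N i) measurable_fst).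
Qed.

Lemma maxdot_trot_sub_le N (c s a b a' b' : R) z :
  a' = c * a + s * b -> b' = c * b - s * a ->
  maxdot N (trot a b z).1 - maxdot N (trot a' b' z).1 <=
  trot_increment N c s (trot a b z).
Proof.
by move=> -> ->; apply: maxdot_sub_le => v; rewrite !tdot_tcomb; ring.
Qed.

End maxdot.

Section pi6_rotation.
Context {R : realType}.

Definition cos_pi6 : R := Num.sqrt 3 / 2.
Definition sin_pi6 : R := 2^-1.

Lemma sqr_cos_pi6 : cos_pi6 ^+ 2 = 3 / 4.
Proof. by rewrite expr_div_n sqr_sqrtr//; field. Qed.

Lemma cos_pi6_ge : 5 / 6 <= cos_pi6.
Proof.
rewrite -(@ler_pXn2r _ 2)// ?nnegrE ?divr_ge0 ?sqrtr_ge0// sqr_cos_pi6; lra.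
Qed.

Lemma cos_sin_pi6 : cos_pi6 ^+ 2 + sin_pi6 ^+ 2 = 1.
Proof. by rewrite sqr_cos_pi6 /sin_pi6; field. Qed.

Definition pi6_increment n (w : nat -> 'cV[R]_n) N := trot_increment w N cos_pi6 sin_pi6.

(* Three rotations by pi/6 lead from the first coordinate to the second. *)
Lemma maxdot_quarter_turn_le n (w : nat -> 'cV[R]_n) N x y :
  maxdot w N y - maxdot w N x <=
  pi6_increment w N (trot cos_pi6 sin_pi6 (x, y)) +
  pi6_increment w N (trot sin_pi6 cos_pi6 (x, y)) +
  pi6_increment w N (trot 0 1 (x, y)).
Proof.
pose inc := pi6_increment w N; rewrite -/inc.
have cosM : cos_pi6 * cos_pi6 = 3 / 4 by rewrite -expr2 sqr_cos_pi6.
have first_turn : maxdot w N (trot cos_pi6 sin_pi6 (x, y)).1 - maxdot w N (trot 1 0 (x, y)).1 <=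
    inc (trot cos_pi6 sin_pi6 (x, y)).
  by apply: maxdot_trot_sub_le; rewrite ?cosM /sin_pi6; field.
have second_turn : maxdot w N (trot sin_pi6 cos_pi6 (x, y)).1 -
    maxdot w N (trot cos_pi6 sin_pi6 (x, y)).1 <= inc (trot sin_pi6 cos_pi6 (x, y)).
  by apply: maxdot_trot_sub_le; rewrite ?cosM /sin_pi6; field.
have third_turn : maxdot w N (trot 0 1 (x, y)).1 - maxdot w N (trot sin_pi6 cos_pi6 (x, y)).1 <=
    inc (trot 0 1 (x, y)).
  by apply: maxdot_trot_sub_le; ring.
move: first_turn third_turn; rewrite /= tcomb01 tcomb10; lra.
Qed.

End pi6_rotation.

Lemma le_sqr_of_mul_le_sqrt {R : rcfType} (r K m : R) : 0 < r -> 0 <= K -> 0 <= m ->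
  r * m <= K * Num.sqrt m -> m <= (K / r) ^+ 2.
Proof.
move=> r0 K0 m0 rm.
rewrite -[m]sqr_sqrtr// ler_pXn2r ?nnegrE ?sqrtr_ge0 ?divr_ge0 ?(ltW r0)//.
rewrite ler_pdivlMr// mulrC; have [->|m_neq0] := eqVneq m 0; first by rewrite sqrtr0 mulr0.
have sm0 : 0 < Num.sqrt m by rewrite sqrtr_gt0 lt_neqAle eq_sym m_neq0.
by rewrite -(ler_pM2r sm0) -mulrA -expr2 sqr_sqrtr.
Qed.

Section maxdot_concentration.
Context {R : realType}.
Variables (sigma : R) (n : nat) (w : nat -> 'cV[R]_n) (N : nat) (L : R).
Hypotheses (sigma_neq0 : sigma != 0) (L_ge0 : 0 <= L).
Hypothesis w_le : forall k, (k < N)%N -> sqn (w k) <= L.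
Notation RR := (measurableTypeR R).
Notation G := (gauss_prob sigma n).
Notation M := (maxdot w N).
Notation inc := (pi6_increment w N).
Local Open Scope ereal_scope.

Let measurable_expR_maxdot a : measurable_fun setT (fun x => (expR (a * M x))%:E).
Proof.
by apply: measurable_expR_EFin; apply: measurable_funM => //; exact: measurable_maxdot.
Qed.

Let measurable_expR_increment a : measurable_fun setT (fun z => (expR (a * inc z))%:E).
Proof.
apply: measurable_expR_EFin; apply: measurable_funM => //.
exact: measurable_trot_increment.
Qed.

Lemma maxdot_mgf_fin_num (th : R) : \int[G]_x (expR (th * M x))%:E \is a fin_num.
Proof.
pose v k := (th *: w k)%R.
have mv k : measurable_fun setT (fun x => (expR (tdot (v k) x))%:E).
  by apply: measurable_expR_EFin; exact: measurable_tdotr.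
rewrite ge0_fin_numE; last by apply: integral_ge0 => x _; rewrite lee_fin expR_ge0.
pose h (x : n.-tuple RR) := 1 + \sum_(k < N) (expR (tdot (v k) x))%:E.
have mh : measurable_fun setT h.
  by apply: emeasurable_funD => //; exact: emeasurable_sum.
apply: (@le_lt_trans _ _ (\int[G]_x h x)).
  apply: ge0_le_integral => //= x _; rewrite /h sumEFin -EFinD lee_fin.
  apply: (maximizer_ind (Q := fun u => expR (th * tdot u x) <= _)%R).
    by rewrite tdot0 mulr0 expR0 lerDl sumr_ge0// => k _; exact: expR_ge0.
  move=> k kN; rewrite -tdotZ -/(v k) (bigD1 (Ordinal kN))//= addrCA lerDl.
  by rewrite addr_ge0// sumr_ge0// => j _; exact: expR_ge0.
rewrite ge0_integralD//; last 2 first.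
- by move=> x _; rewrite sume_ge0// => k _; rewrite lee_fin expR_ge0.
- exact: emeasurable_sum.
rewrite ge0_integral_sum// integral_cst_probability.
by under eq_bigr do rewrite gauss_mgf//; rewrite sumEFin -EFinD ltry.
Qed.

Lemma maxdot_mgf_diff_le (th : R) : (0 <= th)%R ->
  \int[G]_x \int[G]_y (expR (th * (M y - M x)))%:E <=
  \int[G]_x \int[G]_y (expR (3 * (th * inc (x, y))))%:E.
Proof.
move=> th0.
pose F z := (expR (th * (M z.2 - M z.1)))%:E.
pose H z := (expR (3 * (th * inc z)))%:E.
have mF : measurable_fun setT F.
  apply: measurable_expR_EFin; apply: measurable_funM => //; apply: measurable_funB.
    exact: (measurableT_comp (measurable_maxdot w N) measurable_snd).
  exact: (measurableT_comp (measurable_maxdot w N) measurable_fst).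
have mH : measurable_fun setT H.
  by rewrite /H; under eq_fun do rewrite mulrA; exact: measurable_expR_increment.
have F0 z : 0 <= F z by rewrite lee_fin expR_ge0.
have H0 z : 0 <= H z by rewrite lee_fin expR_ge0.
have mHrot c s : measurable_fun setT (H \o @trot _ n c s).
  by apply: measurableT_comp => //; exact: measurable_trot.
have rotE c s : (c ^+ 2 + s ^+ 2 = 1)%R -> (s != 0)%R ->
    \int[G]_x \int[G]_y (H \o @trot _ n c s) (x, y) = \int[G]_x \int[G]_y H (x, y).
  by move=> cs s0; exact: gauss_rotation.
have sin0 : (sin_pi6 != 0 :> R)%R by rewrite invr_eq0.
have cos0 : (cos_pi6 != 0 :> R)%R by rewrite gt_eqF// (lt_le_trans _ cos_pi6_ge).
apply: (ge0_le_integral2_mean3 mF F0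
  (mHrot cos_pi6 sin_pi6) (fun=> H0 _) (mHrot sin_pi6 cos_pi6) (fun=> H0 _)
  (mHrot 0%R 1%R) (fun=> H0 _) _ (rotE _ _ _ _) (rotE _ _ _ _) (rotE _ _ _ _)) => //.
- move=> [x y]; rewrite /F /H /= -!EFinD -EFinM lee_fin.
  apply: le_trans (expR_sum3_le _ _ _); rewrite ler_expR -!mulrDr ler_wpM2l//.
  exact: maxdot_quarter_turn_le.
- exact: cos_sin_pi6.
- by rewrite addrC cos_sin_pi6.
- by rewrite expr0n add0r expr1n.
Qed.

Lemma increment_mgf_le (th : R) : (0 <= th)%R ->
  \int[G]_x \int[G]_y (expR (3 * (th * inc (x, y))))%:E <=
  (expR (9 / 8 * th ^+ 2 * sigma ^+ 2 * L))%:E *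
    \int[G]_x (expR (th / 2 * M x))%:E.
Proof.
move=> th0; rewrite -ge0_integralZl//.
apply: ge0_le_integral => //=.
- by move=> x _; exact: integral_ge0.
- apply: (measurable_fun_fubini_tonelli_F (fun z => (expR (3 * (th * inc z)))%:E)) => //.
  by under eq_fun do rewrite mulrA; exact: measurable_expR_increment.
- exact: emeasurable_funM.
move=> x _; pose a := (3 * th * (1 - cos_pi6) * M x)%R.
have incE y : (3 * (th * inc (x, y)) =
    a + tdot ((3 / 2 * th) *: maximizer w N x) y)%R.
  by rewrite tdotZ /inc /trot_increment /a /sin_pi6 /=; field.
under eq_integral do rewrite incE expRD EFinM.
rewrite ge0_integralZl//; last first.
  by apply: measurable_expR_EFin; exact: measurable_tdotr.
rewrite gauss_mgf// -!EFinM lee_fin mulrC sqnZ.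
have max_le : (sqn (maximizer w N x) <= L)%R.
  by apply: (maximizer_ind (Q := fun v => sqn v <= L)%R) => //; rewrite sqn0.
apply: ler_pM; rewrite ?expR_ge0// ler_expR.
  rewrite (_ : sigma ^+ 2 / 2 * _ =
    9 / 8 * th ^+ 2 * sigma ^+ 2 * sqn (maximizer w N x))%R; last by field.
  by rewrite ler_wpM2l// mulr_ge0 ?sqr_ge0// mulr_ge0 ?sqr_ge0.
rewrite ler_wpM2r ?maxdot_ge0//.
have : (0 <= th * (cos_pi6 - 5 / 6))%R by rewrite mulr_ge0// subr_ge0 cos_pi6_ge.
lra.
Qed.

Lemma maxdot_mgf_le (th a q : R) : (0 <= th)%R -> (0 < q)%R ->
  q%:E <= G [set x | (M x <= a)%R] ->
  \int[G]_x (expR (th * M x))%:E <=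
  (expR (2 * th * a + 9 / 4 * th ^+ 2 * sigma ^+ 2 * L) / q ^+ 2)%:E.
Proof.
move=> th0 q0 qG.
have mM : measurable_fun setT M by exact: measurable_maxdot.
have mE : measurable_fun setT (fun x => expR (th / 2 * M x)).
  by apply: measurableT_comp => //; exact: measurable_funM.
have [m mgfE] : exists m : R, \int[G]_x (expR (th * M x))%:E = m%:E.
  by exists (fine (\int[G]_x (expR (th * M x))%:E)); rewrite fineK// maxdot_mgf_fin_num.
have sqrt_mgf_ge : \int[G]_x (expR (th / 2 * M x))%:E <= (Num.sqrt m)%:E.
  apply: integral_le_sqrt_moment2 => //.
  by rewrite -mgfE; apply: eq_integral => x _; rewrite -expRM_natl mulrA (mulrC 2%R) divfK.
pose K := expR (9 / 8 * th ^+ 2 * sigma ^+ 2 * L).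
pose r := (q * expR (- (th * a)))%R.
have r_gt0 : (0 < r)%R by rewrite mulr_gt0// expR_gt0.
have self_bound : (r * m <= K * Num.sqrt m)%R.
  rewrite -lee_fin EFinM -mgfE.
  apply: le_trans (mgf_diff_ge mM th0 qG) _.
  apply: le_trans (maxdot_mgf_diff_le th0) _.
  apply: le_trans (increment_mgf_le th0) _.
  by rewrite [leRHS]EFinM; apply: lee_wpmul2l => //; rewrite lee_fin expR_ge0.
have m_ge0 : (0 <= m)%R.
  by rewrite -lee_fin -mgfE; apply: integral_ge0 => x _; rewrite lee_fin expR_ge0.
rewrite mgfE lee_fin.
have -> : (expR (2 * th * a + 9 / 4 * th ^+ 2 * sigma ^+ 2 * L) / q ^+ 2 = (K / r) ^+ 2)%R.
  have -> : (K / r = expR (9 / 8 * th ^+ 2 * sigma ^+ 2 * L + th * a) / q)%R.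
    by rewrite /K /r expRN expRD [in LHS]invfM invrK mulrCA mulrC.
  by rewrite expr_div_n -expRM_natl; congr (expR _ / _)%R; field.
by apply: le_sqr_of_mul_le_sqrt => //; exact: expR_ge0.
Qed.

Lemma maxdot_tail (th a q : R) : (0 < th)%R -> (0 < q)%R ->
  q%:E <= G [set x | (M x <= a)%R] ->
  G [set x | (1 <= M x)%R] <=
  (expR (2 * th * a + 9 / 4 * th ^+ 2 * sigma ^+ 2 * L - th) / q ^+ 2)%:E.
Proof.
move=> th0 q0 qG.
apply: (le_trans (chernoff (P := G) M 1%R th0)).
have mgfE : mmt_gen_fun G M th = \int[G]_x (expR (th * M x))%:E.
  by rewrite /mmt_gen_fun expectation_def; apply: eq_integral => x _ /=; rewrite mulrC.
have -> : (expR (2 * th * a + 9 / 4 * th ^+ 2 * sigma ^+ 2 * L - th) / q ^+ 2)%:E =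
    (expR (2 * th * a + 9 / 4 * th ^+ 2 * sigma ^+ 2 * L) / q ^+ 2)%:E * (expR (- (th * 1)))%:E.
  by rewrite mulr1 expRD -EFinM mulrAC.
rewrite mgfE; apply: lee_wpmul2r; first by rewrite lee_fin expR_ge0.
by apply: maxdot_mgf_le => //; exact: ltW.
Qed.

End maxdot_concentration.

Section gauss_concentration.
Context {R : realType}.
Variables (sigma : R) (n : nat) (q tau beta : R).
Hypotheses (sigma_neq0 : sigma != 0) (q_gt0 : 0 < q) (tau_gt0 : 0 < tau).
Hypotheses (beta_gt0 : 0 < beta) (beta_lt1 : beta < 1).
Notation RR := (measurableTypeR R).
Notation G := (gauss_prob sigma n).

Definition concentration_tail : R := expR (- (beta ^+ 2 * tau ^+ 2 / (9 * sigma ^+ 2))) / q ^+ 2.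

Lemma maxdot_concentration (w : nat -> 'cV[R]_n) N :
  (forall k, sqn (w k) <= tau ^- 2) ->
  (q%:E <= G [set x | (maxdot w N x <= (1 - beta) / 2)%R])%E ->
  (G [set x | (1 <= maxdot w N x)%R] <= concentration_tail%:E)%E.
Proof.
move=> w_le med.
pose th := 2 * beta * tau ^+ 2 / (9 * sigma ^+ 2).
have sigma2_gt0 : 0 < sigma ^+ 2 by rewrite exprn_even_gt0.
have th_gt0 : 0 < th.
  by apply: divr_gt0; apply: mulr_gt0 => //; [exact: mulr_gt0|exact: exprn_gt0].
have tauV_ge0 : 0 <= tau ^- 2 by rewrite invr_ge0 exprn_ge0// ltW.
apply: le_trans (maxdot_tail sigma_neq0 tauV_ge0 (fun k _ => w_le k) th_gt0 q_gt0 med) _.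
rewrite lee_fin /concentration_tail le_eqVlt; apply/orP; left; apply/eqP.
by congr (expR _ / _); rewrite /th; field; rewrite sigma_neq0 gt_eqF.
Qed.

Lemma countable_unit_concentration (w : nat -> 'cV[R]_n) (A : set (n.-tuple RR)) :
  (forall k, sqn (w k) <= tau ^- 2) -> measurable A -> (q%:E <= G A)%E ->
  (forall x, A x -> forall k, tdot (w k) x <= (1 - beta) / 2) ->
  exists2 E : set (n.-tuple RR), measurable E &
    ((1 - concentration_tail)%:E <= G E)%E /\
    forall x, E x -> forall k, tdot (w k) x <= 1.
Proof.
move=> w_le mA qA A_le.
pose F N := [set x | 1 <= maxdot w N x].
have mF N : measurable (F N) by apply: measurable_set_le => //; exact: measurable_maxdot.
have GF N : (G (F N) <= concentration_tail%:E)%E.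
  apply: maxdot_concentration => //; apply: (le_trans qA); apply: le_measure.
  - exact: mem_set.
  - by apply: mem_set; apply: measurable_set_le => //; exact: measurable_maxdot.
  move=> x Ax; apply: maxdot_le => [|k _]; last exact: A_le.
  by rewrite divr_ge0// subr_ge0 ltW.
have ndF : nondecreasing_seq F.
  move=> M N MN; apply/subsetPset => x /= /le_trans; apply.
  exact: maxdot_nondecreasing.
have mU : measurable (\bigcup_N F N) by exact: bigcup_measurable.
have GU : (G (\bigcup_N F N) <= concentration_tail%:E)%E.
  have cvF := nondecreasing_cvg_mu (mu := G) mF mU ndF.
  rewrite -(cvg_lim _ cvF)//; apply: lime_le; first by apply/cvg_ex; eexists; exact: cvF.
  by apply: nearW => N; exact: GF.
exists (~` \bigcup_N F N); first exact: measurableC.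
split; first by rewrite probability_setC// EFinB; exact: leeB.
move=> x /= xF k; rewrite leNgt; apply/negP => wk1; apply: xF; exists k.+1 => //.
by rewrite /F /= (le_trans (ltW wk1))// maxdot_ge.
Qed.

Lemma countable_concentration (z : nat -> 'cV[R]_n) (b : nat -> R) (A : set (n.-tuple RR)) :
  (forall k, 0 <= b k) -> measurable A -> (q%:E <= G A)%E ->
  (forall x, A x -> forall k, tdot (z k) x <= b k) ->
  exists2 E : set (n.-tuple RR), measurable E &
    ((1 - concentration_tail)%:E <= G E)%E /\
    forall x, E x -> forall k, tdot (z k) x <= 2 / (1 - beta) * b k + tau * l2 (z k).
Proof.
move=> b0 mA qA A_le; have factor_gt0 : 0 < 2 / (1 - beta) by rewrite divr_gt0// subr_gt0.
pose B k := 2 / (1 - beta) * b k + tau * l2 (z k).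
have B0 k : 0 <= B k by rewrite addr_ge0// mulr_ge0 ?l2_ge0// ltW.
have z_le k : tau * l2 (z k) <= B k by rewrite lerDr mulr_ge0// ltW.
pose w k := (B k)^-1 *: z k.
have B_eq0_or_gt0 k : B k = 0 /\ z k = 0 \/ 0 < B k.
  have [Bk|Bk] := eqVneq (B k) 0; last by right; rewrite lt_neqAle eq_sym Bk B0.
  left; split=> //; apply: l2_eq0; apply/eqP; rewrite eq_le l2_ge0 andbT.
  by rewrite -(ler_pM2l tau_gt0) mulr0 -Bk.
have w_le k : sqn (w k) <= tau ^- 2.
  rewrite sqnZ; have [[_ ->]|Bk] := B_eq0_or_gt0 k.
    by rewrite sqn0 mulr0 invr_ge0 exprn_ge0// ltW.
  rewrite exprVn -sqr_l2 mulrC ler_pdivrMr ?exprn_gt0// mulrC ler_pdivlMr ?exprn_gt0//.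
  by rewrite -exprMn ler_pXn2r ?nnegrE ?B0 ?mulr_ge0 ?l2_ge0 ?(ltW tau_gt0)// mulrC.
have w_A x : A x -> forall k, tdot (w k) x <= (1 - beta) / 2.
  move=> Ax k; rewrite tdotZ; have [[_ ->]|Bk] := B_eq0_or_gt0 k.
    by rewrite tdot0 mulr0 divr_ge0// subr_ge0 ltW.
  rewrite mulrC ler_pdivrMr// (le_trans (A_le _ Ax k))// /B mulrDr mulrA.
  rewrite (_ : (1 - beta) / 2 * (2 / (1 - beta)) = 1); last first.
    by field; rewrite gt_eqF// subr_gt0.
  rewrite mul1r lerDl; apply: mulr_ge0; last by rewrite mulr_ge0 ?l2_ge0// ltW.
  by rewrite divr_ge0// subr_ge0 ltW.
have [E mE [GE E_le]] := countable_unit_concentration w_le mA qA w_A.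
exists E => //; split => // x /E_le wx k; have := wx k.
rewrite tdotZ mulrC -/(B k); have [[-> ->]|Bk] := B_eq0_or_gt0 k; first by rewrite tdot0.
by rewrite ler_pdivrMr// mul1r.
Qed.

Lemma sublinear_concentration m (M : 'M[R]_(n, m)) (N : 'cV[R]_m -> R) (C : R)
    (A : set (n.-tuple RR)) : 0 <= C -> (forall u, 0 <= N u <= C * l1 u) ->
  (forall u v, N (u + v) <= N u + N v) -> measurable A -> (q%:E <= G A)%E ->
  (forall x, A x -> forall u, tdot (M *m u) x <= N u) ->
  exists2 E : set (n.-tuple RR), measurable E &
    ((1 - concentration_tail)%:E <= G E)%E /\
    forall x, E x -> forall u,
      tdot (M *m u) x <= 2 / (1 - beta) * N u + tau * l2 (M *m u).
Proof.
move=> C0 N_bound N_subadd mA qA A_le; set c := 2 / (1 - beta).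
have c0 : 0 < c by rewrite divr_gt0// subr_gt0.
have N0 u : 0 <= N u by have /andP[] := N_bound u.
have [E mE [GE E_le]] := countable_concentration (fun k => N0 (rat_vec m k)) mA qA
  (fun x Ax k => A_le x Ax (rat_vec m k)).
rewrite -/c in E_le; exists E => //; split => // x Ex u; rewrite -subr_ge0.
pose norm_M := \sum_(i < n) \sum_(j < m) `|M i j|.
have norm_M0 : 0 <= norm_M by rewrite sumr_ge0// => i _; exact: sumr_ge0.
pose norm_x := \sum_(i < n) `|tnth x i : R|.
have norm_x0 : 0 <= norm_x by exact: sumr_ge0.
clearbody c.
move: u; apply: (ge0_of_rat_vec (C := c * C + tau * norm_M + norm_x * norm_M)).
- by rewrite addr_ge0 ?addr_ge0 ?mulr_ge0 ?(ltW c0) ?(ltW tau_gt0).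
- move=> u v; have [d ->] : exists d, v = u + d by exists (v - u); rewrite addrC subrK.
  rewrite (_ : u + d - u = d); last by rewrite addrC addKr.
  rewrite mulmxDr tdotD.
  have N_lip : N (u + d) <= N u + C * l1 d.
    by rewrite (le_trans (N_subadd _ _))// lerD2l; have /andP[] := N_bound d.
  have l1_Md_le : l1 (M *m d) <= norm_M * l1 d by exact: l1_mulmx.
  have l2_Md_le : l2 (M *m u + M *m d) <= l2 (M *m u) + norm_M * l1 d.
    by rewrite (le_trans (l2_triangle _ _))// lerD2l (le_trans (l2_le_l1 _)).
  have tdot_Md_ge : - tdot (M *m d) x <= norm_x * (norm_M * l1 d).
    by rewrite (le_trans _ (ler_wpM2l norm_x0 l1_Md_le))// tdot_ge_l1.
  have := ler_wpM2l (ltW c0) N_lip; have := ler_wpM2l (ltW tau_gt0) l2_Md_le; lra.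
- by move=> k; rewrite subr_ge0; exact: E_le.
Qed.

End gauss_concentration.

(** * The sorted l1 norm *)

Section sum_comparison.
Context {R : realDomainType}.

Lemma sum_mul_le_abel (a b c : nat -> R) l :
  (forall i j, (i <= j < l)%N -> c j <= c i) -> (forall i, 0 <= c i) ->
  (forall q, (q <= l)%N -> \sum_(j < q) a j <= \sum_(j < q) b j) ->
  \sum_(j < l) c j * a j <= \sum_(j < l) c j * b j.
Proof.
move=> c_ninc c0 ab; rewrite -subr_ge0 -sumrB.
case: l => [|l] in c_ninc ab *; first by rewrite big_ord0.
apply: (@le_trans _ _ (c l * \sum_(j < l.+1) (b j - a j))).
  by rewrite mulr_ge0// sumrB subr_ge0 ab.
elim: l => [|l IH] in c_ninc ab *; first by rewrite !big_ord1 mulrBr.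
rewrite big_ord_recr [leRHS]big_ord_recr/= mulrDr mulrBr lerD2r.
apply: le_trans (IH _ _); first last.
- by move=> q ql; rewrite ab// ltnW.
- by move=> i j /andP[ij jl]; rewrite c_ninc// ij ltnW.
by rewrite ler_wpM2r ?c_ninc ?leqnSn//= sumrB subr_ge0 ab.
Qed.

Lemma sum_set_le_head m (f : nat -> R) q (B : {set 'I_m}) :
  (forall i j, (i <= j)%N -> f j <= f i) -> (forall j, 0 <= f j) ->
  (#|B| <= q <= m)%N -> \sum_(j in B) f j <= \sum_(j < q) f j.
Proof.
move=> f_ninc f0 /andP[Bq qm].
have sum_sub_le : \sum_(j in B) (f j - f q) <= \sum_(j < q) (f j - f q).
  rewrite (big_ord_widen m (fun j => f j - f q) qm) [leLHS]big_mkcond [leRHS]big_mkcond/=.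
  apply: ler_sum => j _; case: ifP => _; case: ltnP => jq //.
    by rewrite subr_le0 f_ninc.
  by rewrite subr_ge0 f_ninc// ltnW.
have := ler_wpMn2l (f0 q) Bq; move: sum_sub_le.
by rewrite !sumrB !sumr_const card_ord; lra.
Qed.

End sum_comparison.

Lemma exists_subset_card {I : finType} (A : {set I}) q : (q <= #|A|)%N ->
  exists2 B : {set I}, B \subset A & #|B| = q.
Proof.
move=> qA; have : (0 < #|[set B : {set I} | B \subset A & #|B| == q]%SET|)%N.
  by rewrite cards_draws bin_gt0.
by move=> /card_gt0P[B]; rewrite inE => /andP[BA /eqP cardB]; exists B.
Qed.

Lemma card_ord_lt m q : (q <= m)%N -> #|[set j : 'I_m | (j < q)%N]%SET| = q.
Proof.
move=> qm; rewrite -sum1dep_card (eq_bigl (fun j : 'I_m => (j < q)%N))//.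
by rewrite -(big_ord_widen m (fun=> 1%N) qm) sum1_card card_ord.
Qed.

Lemma sum_perm_head {V : nmodType} m (p : {perm 'I_m}) q (f : 'I_m -> V) : (q <= m)%N ->
  exists2 A : {set 'I_m}, #|A| = q & \sum_(j < m | (j < q)%N) f (p j) = \sum_(i in A) f i.
Proof.
move=> qm; exists (p @: [set j : 'I_m | (j < q)%N]%SET).
  by rewrite card_imset ?card_ord_lt//; exact: perm_inj.
rewrite big_imset/=; last by move=> ? ? _ _; exact: perm_inj.
by apply: eq_bigl => j; rewrite inE.
Qed.

Section sorted_abs.
Context {R : realType} {m : nat}.
Implicit Types u v : 'cV[R]_m.

Let geR (a b : R) := b <= a.

Lemma sorted_abs_perm u :
  exists p : {perm 'I_m}, forall j : 'I_m, sorted_abs u j = `|u (p j) 0|.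
Proof.
pose t : m.-tuple R := [tuple (`|u i 0| : R) | i < m].
have /tuple_permP[p sE] : perm_eq (sort geR t) t by rewrite perm_sort.
exists p => j; rewrite /sorted_abs -/geR (_ : [seq `|u i 0| | i <- enum 'I_m] = t)// sE.
by rewrite -tnth_nth !tnth_mktuple.
Qed.

Lemma sorted_abs_default u j : (m <= j)%N -> sorted_abs u j = 0.
Proof. by move=> mj; rewrite /sorted_abs nth_default// size_sort size_map size_enum_ord. Qed.

Lemma sorted_abs_ge0 u j : 0 <= sorted_abs u j.
Proof.
have [jm|/sorted_abs_default -> //] := ltnP j m.
by have [p /(_ (Ordinal jm)) /= ->] := sorted_abs_perm u.
Qed.

Lemma sorted_abs_ninc u i j : (i <= j)%N -> sorted_abs u j <= sorted_abs u i.
Proof.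
move=> ij; have [jm|/sorted_abs_default ->] := ltnP j m; last exact: sorted_abs_ge0.
have size_s : size (sort geR [seq `|u i 0| | i <- enum 'I_m]) = m.
  by rewrite size_sort size_map size_enum_ord.
apply: (@sorted_leq_nth _ geR _ _ 0); rewrite ?inE ?size_s//.
- by move=> x y z /[swap]; exact: le_trans.
- by move=> x; exact: lexx.
- by apply: sort_sorted => x y; exact: le_total.
- exact: leq_ltn_trans jm.
Qed.

Lemma sorted_absN u j : sorted_abs (- u) j = sorted_abs u j.
Proof. by congr (nth _ (sort _ _) _); apply: eq_map => i; rewrite mxE normrN. Qed.

Lemma sum_sorted_abs (phi : R -> R) u :
  \sum_(j < m) phi (sorted_abs u j) = \sum_(i < m) phi `|u i 0|.
Proof.
have [p pE] := sorted_abs_perm u.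
by rewrite [RHS](reindex_inj (@perm_inj _ p))/=; apply: eq_bigr => i _; rewrite pE.
Qed.

Lemma sorted_abs_sum_ge (phi : R -> R) u (j : 'I_m) :
  {in Num.nneg &, {homo phi : x y / x <= y}} -> (forall x, 0 <= phi x) ->
  j.+1%:R * phi (sorted_abs u j) <= \sum_(i < m) phi `|u i 0|.
Proof.
move=> phi_nd phi0; rewrite -sum_sorted_abs mulr_natl -[X in _ *+ X](card_ord j.+1) -sumr_const.
rewrite (bigID (fun i : 'I_m => (i < j.+1)%N))/=.
rewrite -(big_ord_widen m (fun i => phi (sorted_abs u i)))//.
rewrite ler_wpDr ?sumr_ge0//; apply: ler_sum => i _.
by apply: phi_nd; rewrite ?nnegrE ?sorted_abs_ge0//; apply: sorted_abs_ninc; rewrite -ltnS.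
Qed.

(* The Ky Fan norm: by summation by parts a sorted l1 norm is a nonnegative
   combination of these. *)
Definition topsum u q : R := \sum_(j < q) sorted_abs u j.

Lemma topsum_ge u q (A : {set 'I_m}) : (#|A| <= q <= m)%N ->
  \sum_(i in A) `|u i 0| <= topsum u q.
Proof.
move=> Aqm; have [p pE] := sorted_abs_perm u.
rewrite (reindex_inj (@perm_inj _ p))/=; under eq_bigr do rewrite -pE.
rewrite (eq_bigl [in p @^-1: A]); last by move=> j; rewrite inE.
apply: (sum_set_le_head (f := sorted_abs u)); first exact: sorted_abs_ninc.
- exact: sorted_abs_ge0.
- by rewrite card_preimset//; exact: perm_inj.
Qed.

Lemma topsum_attained u q : (q <= m)%N ->
  exists2 A : {set 'I_m}, #|A| = q & topsum u q = \sum_(i in A) `|u i 0|.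
Proof.
move=> qm; have [p pE] := sorted_abs_perm u.
have [A cardA sumA] := sum_perm_head p (fun i => `|u i 0|) qm.
exists A => //; rewrite -sumA /topsum (big_ord_widen m (sorted_abs u) qm).
by apply: eq_bigr => j _; rewrite pE.
Qed.

Lemma topsumN u q : topsum (- u) q = topsum u q.
Proof. by apply: eq_bigr => j _; rewrite sorted_absN. Qed.

Lemma topsum_triangle u v q : (q <= m)%N -> topsum (u + v) q <= topsum u q + topsum v q.
Proof.
move=> qm; have [A cardA ->] := topsum_attained (u + v) qm.
have Aq : (#|A| <= q <= m)%N by rewrite cardA leqnn.
apply: le_trans (lerD (topsum_ge u Aq) (topsum_ge v Aq)).
by rewrite -big_split/=; apply: ler_sum => i _; rewrite mxE ler_normD.
Qed.

Lemma topsum_scale_le a u q : (q <= m)%N -> topsum (a *: u) q <= `|a| * topsum u q.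
Proof.
move=> qm; have [A cardA ->] := topsum_attained (a *: u) qm.
rewrite (eq_bigr (fun i => `|a| * `|u i 0|)) => [|i _]; last by rewrite mxE normrM.
by rewrite -mulr_sumr ler_wpM2l// topsum_ge// cardA leqnn.
Qed.

Lemma topsum_support (S : {set 'I_m}) u q : (q <= m)%N ->
  (forall i, i \notin S -> u i 0 = 0) -> topsum u q <= \sum_(i in S) `|u i 0|.
Proof.
move=> qm uS; have [A _ ->] := topsum_attained u qm.
rewrite [leLHS]big_mkcond [leRHS]big_mkcond; apply: ler_sum => i _.
by case: ifP => _; case: ifPn => // /uS ->; rewrite normr0.
Qed.

(* With S the support of b, a set T realising [topsum u q] with q > k is
   exchanged for S together with all of T but as many elements as S has
   outside T; both sets of lost terms have at most k elements. *)
Lemma topsum_support_exchange (S : {set 'I_m}) (b u : 'cV[R]_m) k q :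
  (#|S| <= k < q)%N -> (q <= m)%N -> (forall i, i \notin S -> b i 0 = 0) ->
  topsum b q + topsum u q <= topsum (b + u) q + 2 * topsum u k.
Proof.
have term_le (x y : R) (inS inT inD : bool) : (~~ inS -> x = 0) ->
    (if inS then `|x| else 0) + (if inT then `|y| else 0) <=
    (if inS || ~~ inD && (~~ inS && inT) then `|x + y| else 0) +
    (if inS then `|y| else 0) + (if inS && inT || inD then `|y| else 0).
  have := normr_ge0 y; have := ler_normB (x + y) y; rewrite addrK.
  by case: inS => [xy y0 _|_ y0 /(_ isT) ->]; case: inT; case: inD => /=; rewrite ?add0r; lra.
move=> /andP[Sk kq] qm bS; have km : (k <= m)%N by exact: leq_trans (ltnW kq) qm.
have [T cardT ->] := topsum_attained u qm.
have cardST : (#|S :&: T| + #|S :\: T| = #|S|)%N by exact: cardsID.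
have cardTS : (#|S :&: T| + #|T :\: S| = q)%N by rewrite finset.setIC cardsID.
have [D DTS cardD] : exists2 D : {set 'I_m}, D \subset T :\: S & #|D| = #|S :\: T|.
  by apply: exists_subset_card; lia.
pose W := S :|: (T :\: S :\: D); pose V := (S :&: T) :|: D.
have cardW : (#|W| <= q <= m)%N.
  by rewrite qm andbT (leq_trans (leq_card_setU _ _).1)// cardsDS//; lia.
have cardV : (#|V| <= k <= m)%N.
  by rewrite km andbT (leq_trans (leq_card_setU _ _).1)//; lia.
have cardS : (#|S| <= k <= m)%N by rewrite Sk.
apply: (@le_trans _ _ (\sum_(i in S) `|b i 0| + \sum_(i in T) `|u i 0|)).
  by rewrite lerD2r topsum_support.
apply: (@le_trans _ _ (\sum_(i in W) `|(b + u) i 0| +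
    \sum_(i in S) `|u i 0| + \sum_(i in V) `|u i 0|)); last first.
  by rewrite mulr_natl mulr2n addrA !lerD// topsum_ge.
rewrite ![\sum_(i in _) _]big_mkcond -!big_split/=.
apply: ler_sum => i _; rewrite !inE mxE.
exact: term_le (bS i).
Qed.

Lemma topsum_decomposable (S : {set 'I_m}) (b u : 'cV[R]_m) k q :
  (#|S| <= k)%N -> (q <= m)%N -> (forall i, i \notin S -> b i 0 = 0) ->
  topsum b q + topsum u q <= topsum (b + u) q + 2 * topsum u (minn q k).
Proof.
move=> Sk qm bS; case: (leqP q k) => [qk|kq]; last first.
  by apply: (topsum_support_exchange _ _ qm bS); rewrite Sk.
by have := topsum_triangle (b + u) (- u) qm; rewrite addrK topsumN; lra.
Qed.

End sorted_abs.

Section Jsl.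
Context {R : realType} {m : nat}.
Implicit Types u v : 'cV[R]_m.

Lemma dotv_le_sorted_abs u v :
  dotv u v <= \sum_(j < m) sorted_abs v j * sorted_abs u j.
Proof.
have [p pE] := sorted_abs_perm v.
pose a j := oapp (fun i : 'I_m => `|u (p i) 0|) 0 (insub j).
have aE (j : 'I_m) : a j = `|u (p j) 0| by rewrite /a valK.
apply: (@le_trans _ _ (\sum_(j < m) sorted_abs v j * a j)).
  rewrite /dotv (reindex_inj (@perm_inj _ p))/=; apply: ler_sum => j _.
  by rewrite pE aE mulrC (le_trans (ler_norm _))// normrM.
apply: sum_mul_le_abel => [i j /andP[ij _]||q qm]; [exact: sorted_abs_ninc|exact: sorted_abs_ge0|].
have [A cardA sumA] := sum_perm_head p (fun i => `|u i 0|) qm.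
rewrite (big_ord_widen m a qm) (eq_bigr _ (fun j _ => aE j)) sumA topsum_ge//.
by rewrite cardA leqnn.
Qed.

Variable lam : nat -> R.
Hypothesis lam_ge0 : forall j, 0 <= lam j.
Hypothesis lam_ninc : forall i j, (0 < i <= j)%N -> lam j <= lam i.

Lemma Jsl_le_topsum u (b : nat -> R) :
  (forall q, (q <= m)%N -> topsum u q <= \sum_(j < q) b j) ->
  Jsl lam u <= \sum_(j < m) lam j.+1 * b j.
Proof.
move=> ub; apply: (sum_mul_le_abel (c := fun j => lam j.+1)) => // i j /andP[ij _].
exact: lam_ninc.
Qed.

Lemma Jsl_ge0 u : 0 <= Jsl lam u.
Proof. by rewrite sumr_ge0// => j _; rewrite mulr_ge0// sorted_abs_ge0. Qed.

Lemma Jsl_triangle u v : Jsl lam (u + v) <= Jsl lam u + Jsl lam v.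
Proof.
rewrite -big_split/=; under eq_bigr do rewrite -mulrDr.
apply: (Jsl_le_topsum (b := fun j => sorted_abs u j + sorted_abs v j)) => q qm.
by rewrite big_split; exact: topsum_triangle.
Qed.

Lemma Jsl_scale_le a u : Jsl lam (a *: u) <= `|a| * Jsl lam u.
Proof.
rewrite mulr_sumr; under eq_bigr do rewrite mulrCA.
apply: (Jsl_le_topsum (b := fun j => `|a| * sorted_abs u j)) => q qm.
by rewrite -mulr_sumr; exact: topsum_scale_le.
Qed.

Lemma Jsl_convex (a b : 'cV[R]_m) (t : R) : 0 <= t <= 1 ->
  Jsl lam (a + t *: (b - a)) <= Jsl lam a + t * (Jsl lam b - Jsl lam a).
Proof.
move=> /andP[t0 t1].
rewrite (_ : a + _ = (1 - t) *: a + t *: b); last by apply/colP => i; rewrite !mxE; ring.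
have := Jsl_triangle ((1 - t) *: a) (t *: b).
have := Jsl_scale_le (1 - t) a; have := Jsl_scale_le t b.
by rewrite (ger0_norm t0) ger0_norm ?subr_ge0//; lra.
Qed.

Lemma Jsl_le_l1 u : Jsl lam u <= lam 1%N * l1 u.
Proof.
rewrite /l1 -(sum_sorted_abs id) mulr_sumr; apply: ler_sum => j _.
by rewrite ler_wpM2r ?sorted_abs_ge0// lam_ninc.
Qed.

Lemma l0_card u : l0 u = #|[set i : 'I_m | u i 0 != 0]%SET|.
Proof.
rewrite /l0 !cardE /enum_mem; congr size; apply: eq_filter => i.
by rewrite !inE; apply/idP/idP => [/set_mem|/mem_set].
Qed.

Lemma Jsl_decomposable (k : nat) (b u : 'cV[R]_m) : (l0 b <= k <= m)%N ->
  Jsl lam b + Jsl lam u - Jsl lam (b + u) <= 2 * \sum_(j < k) lam j.+1 * sorted_abs u j.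
Proof.
move=> /andP[bk km]; pose head j := if (j < k)%N then sorted_abs u j else 0.
have -> : \sum_(j < k) lam j.+1 * sorted_abs u j = \sum_(j < m) lam j.+1 * head j.
  rewrite (big_ord_widen m (fun j => lam j.+1 * sorted_abs u j) km) big_mkcond/=.
  by apply: eq_bigr => j _; rewrite /head; case: ifP; rewrite ?mulr0.
rewrite lerBlDl mulr_sumr -!big_split/=.
under eq_bigr do rewrite -mulrDr; under [leRHS]eq_bigr do rewrite mulrCA -mulrDr.
apply: (sum_mul_le_abel (c := fun j => lam j.+1)
  (a := fun j => sorted_abs b j + sorted_abs u j)
  (b := fun j => sorted_abs (b + u) j + 2 * head j)) => // [i j /andP[ij _]|q qm].
  exact: lam_ninc.
have head_sum : \sum_(j < q) head j = topsum u (minn q k).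
  rewrite /topsum (big_ord_widen q (sorted_abs u) (geq_minl _ _)) [RHS]big_mkcond/=.
  by apply: eq_bigr => j _; rewrite /head leq_min ltn_ord.
rewrite !big_split/= -mulr_sumr head_sum.
apply: (topsum_decomposable (S := [set i | b i 0 != 0]%SET)) => //; first by rewrite -l0_card.
by move=> i; rewrite inE negbK => /eqP.
Qed.

Lemma head_le_l2 k u : (k <= m)%N ->
  \sum_(j < k) lam j.+1 * sorted_abs u j <= Num.sqrt (\sum_(j < k) lam j.+1 ^+ 2) * l2 u.
Proof.
move=> km; apply: (le_trans (sum_mul_le_sqrt _ _)).
rewrite ler_wpM2l ?sqrtr_ge0// ler_wsqrtr//.
rewrite (big_ord_widen m (fun j => sorted_abs u j ^+ 2) km).
have -> : sqn u = \sum_(j < m) sorted_abs u j ^+ 2.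
  rewrite (sum_sorted_abs (fun x => x ^+ 2)).
  by apply: eq_bigr => i _; rewrite real_normK ?num_real.
rewrite [leRHS](bigID (fun j : 'I_m => (j < k)%N))/= lerDl.
by rewrite sumr_ge0// => j _; exact: sqr_ge0.
Qed.

End Jsl.

(** * Square-root logarithmic weights *)

Section weights.
Context {R : realType}.

Lemma lamw_ge0 (sigma : R) m j : 0 <= sigma -> 0 <= lamw sigma m j.
Proof. by move=> s0; rewrite mulr_ge0 ?sqrtr_ge0. Qed.

Lemma lamw_ninc (sigma : R) m i j : 0 <= sigma -> (0 < m)%N -> (0 < i <= j)%N ->
  lamw sigma m j <= lamw sigma m i.
Proof.
move=> s0 m0 /andP[i0 ij]; have j0 := leq_trans i0 ij.
rewrite ler_wpM2l// ler_wsqrtr// ler_ln ?posrE ?divr_gt0 ?mulr_gt0 ?ltr0n//.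
by rewrite ler_wpM2l ?mulr_ge0// lef_pV2 ?posrE ?ltr0n ?ler_nat.
Qed.

Lemma lamw_last (sigma : R) m : (0 < m)%N -> lamw sigma m m = sigma * Num.sqrt (ln 2).
Proof. by move=> m0; rewrite /lamw mulfK// pnatr_eq0 -lt0n. Qed.

Lemma two_le_ratio m j : (0 < j <= m)%N -> 2 <= 2 * m%:R / j%:R :> R.
Proof. by move=> /andP[j0 jm]; rewrite ler_pdivlMr ?ltr0n// ler_pM2l// ler_nat. Qed.

Lemma sqr_lamw (sigma : R) m j : (0 < j <= m)%N ->
  lamw sigma m j ^+ 2 = sigma ^+ 2 * ln (2 * m%:R / j%:R).
Proof.
by move=> jm; rewrite exprMn sqr_sqrtr// ln_ge0// (le_trans _ (two_le_ratio jm))// ler1n.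
Qed.

End weights.

Lemma mulr_lnS_le {R : realType} q : q%:R * (ln q.+1%:R - ln q%:R) <= 1 :> R.
Proof.
case: q => [|q]; first by rewrite mul0r.
rewrite -ln_div ?posrE ?ltr0n// mulrC -ler_pdivlMr// mul1r.
have -> : q.+2%:R / q.+1%:R = 1 + q.+1%:R^-1 :> R.
  by rewrite -[q.+2%:R]natr1 mulrDl divff ?gt_eqF// mul1r.
by rewrite le_ln1Dx// (lt_trans (ltrN10 _))// invr_gt0.
Qed.

Section head_weights.
Context {R : realType}.
Variables (sigma : R) (p k : nat).
Hypotheses (k_gt0 : (0 < k)%N) (kp : (k <= p)%N).

Definition head_norm : R := Num.sqrt (\sum_(j < k) lamw sigma p j.+1 ^+ 2).

Definition log_ratio : R := k%:R * ln (2 * p%:R / k%:R).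

Definition log_ratio_e : R := k%:R * ln (2 * expR 1 * p%:R / k%:R).

Let p_gt0 : 0 < p%:R :> R. Proof. by rewrite ltr0n (leq_trans k_gt0). Qed.
Let k_gt0R : 0 < k%:R :> R. Proof. by rewrite ltr0n. Qed.

Lemma head_norm_ge0 : 0 <= head_norm. Proof. exact: sqrtr_ge0. Qed.

Lemma sqr_head_norm : head_norm ^+ 2 = \sum_(j < k) lamw sigma p j.+1 ^+ 2.
Proof. by rewrite sqr_sqrtr// sumr_ge0// => j _; exact: sqr_ge0. Qed.

Lemma sqr_head_norm_le : head_norm ^+ 2 <= sigma ^+ 2 * log_ratio_e.
Proof.
rewrite sqr_head_norm /log_ratio_e.
have -> : ln (2 * expR 1 * p%:R / k%:R) = ln (2 * p%:R : R) + 1 - ln k%:R.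
  rewrite ln_div ?posrE ?mulr_gt0 ?expR_gt0// [in LHS]mulrAC.
  by rewrite [in LHS]lnM ?posrE ?mulr_gt0 ?expR_gt0// expRK.
have sqrE (j : 'I_k) : lamw sigma p j.+1 ^+ 2 = sigma ^+ 2 * (ln (2 * p%:R) - ln j.+1%:R).
  by rewrite sqr_lamw ?(leq_trans (ltn_ord j))// ln_div// posrE ?mulr_gt0.
under eq_bigr do rewrite sqrE.
rewrite -mulr_sumr ler_wpM2l ?sqr_ge0//; elim: (k) => [|q IH]; first by rewrite big_ord0 mul0r.
rewrite big_ord_recr/= (le_trans (lerD IH (lexx _)))//.
by have := mulr_lnS_le (R := R) q; rewrite -[q.+1%:R]natr1; lra.
Qed.

Lemma sqr_head_norm_ge : sigma ^+ 2 * log_ratio <= head_norm ^+ 2.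
Proof.
rewrite sqr_head_norm /log_ratio mulrCA -sqr_lamw ?k_gt0//.
rewrite mulr_natl -[X in _ *+ X](card_ord k) -sumr_const.
apply: ler_sum => j _; rewrite !sqr_lamw ?k_gt0// ?(leq_trans (ltn_ord j))//.
rewrite ler_wpM2l ?sqr_ge0// ler_ln ?posrE ?divr_gt0 ?mulr_gt0//.
by rewrite ler_pM2l ?mulr_gt0// lef_pV2 ?posrE ?ltr0n// ler_nat.
Qed.

Lemma lamw_first_le_head_norm : 0 <= sigma -> lamw sigma p 1 <= head_norm.
Proof.
move=> s0; rewrite -(@ler_pXn2r _ 2)// ?nnegrE ?lamw_ge0 ?head_norm_ge0//.
rewrite sqr_head_norm; case: (k) k_gt0 => // k' _.
by rewrite big_ord_recl lerDl sumr_ge0// => j _; exact: sqr_ge0.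
Qed.

Lemma log_ratio_ge : ln 2 <= log_ratio.
Proof.
have le_ln : ln 2 <= ln (2 * p%:R / k%:R) :> R.
  by rewrite ler_ln ?posrE ?divr_gt0 ?mulr_gt0// two_le_ratio// k_gt0.
apply: (le_trans le_ln); rewrite ler_peMl ?ler1n//.
by apply: le_trans le_ln; rewrite ln_ge0// ler1n.
Qed.

Lemma expRN_log_ratio : expR (- log_ratio) = (k%:R / (2 * p%:R)) ^+ k.
Proof.
rewrite -mulrN expRM_natl -lnV ?posrE ?divr_gt0 ?mulr_gt0//.
by rewrite lnK ?posrE ?invr_gt0 ?divr_gt0 ?mulr_gt0// invf_div.
Qed.

End head_weights.

(** * The noise event *)

Section correlations.
Context {R : realType}.
Variables (sigma : R) (n : nat).
Hypothesis sigma_gt0 : 0 < sigma.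
Notation RR := (measurableTypeR R).
Notation G := (gauss_prob sigma n).

Let sigma_neq0 : sigma != 0. Proof. exact: lt0r_neq0. Qed.

Definition correlations p (X : 'M[R]_(n, p)) (x : n.-tuple RR) : 'cV[R]_p :=
  \col_j tdot (col j X) x.

Lemma tdot_mulmx p (X : 'M[R]_(n, p)) u x : tdot (X *m u) x = dotv u (correlations X x).
Proof.
rewrite /tdot; under eq_bigr do rewrite mxE mulr_suml.
rewrite exchange_big/=; apply: eq_bigr => j _; rewrite mxE /tdot mulr_sumr.
by apply: eq_bigr => i _; rewrite mxE mulrCA mulrA.
Qed.

Definition exp_energy p (X : 'M[R]_(n, p)) (x : n.-tuple RR) : R :=
  \sum_(j < p) expR (3 / (8 * sigma ^+ 2) * correlations X x j 0 ^+ 2).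

Lemma measurable_exp_energy_term p (X : 'M[R]_(n, p)) j : measurable_fun setT
  (fun x => expR (3 / (8 * sigma ^+ 2) * correlations X x j 0 ^+ 2)).
Proof.
apply: measurableT_comp => //; apply: measurable_funM => //; apply: measurable_funX.
by under eq_fun do rewrite mxE; exact: measurable_tdotr.
Qed.

Lemma measurable_exp_energy p (X : 'M[R]_(n, p)) : measurable_fun setT (exp_energy X).
Proof. by apply: measurable_sum => j; exact: measurable_exp_energy_term. Qed.

HB.instance Definition _ p (X : 'M[R]_(n, p)) :=
  isMeasurableFun.Build _ _ _ _ (exp_energy X) (measurable_exp_energy X).

Lemma exp_energy_ge0 p (X : 'M[R]_(n, p)) x : 0 <= exp_energy X x.
Proof. by rewrite sumr_ge0// => j _; exact: expR_ge0. Qed.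

Lemma integral_exp_energy p (X : 'M[R]_(n, p)) : (forall j, sqn (col j X) = 1) ->
  (\int[G]_x (exp_energy X x)%:E = (2 * p%:R)%:E)%E.
Proof.
move=> X1; under eq_integral do rewrite /exp_energy -sumEFin.
rewrite ge0_integral_sum//; last first.
  by move=> j; apply/measurable_EFinP; exact: measurable_exp_energy_term.
have coefE j : 2 * (3 / (8 * sigma ^+ 2)) * sigma ^+ 2 * sqn (col j X) = 3 / 4.
  by rewrite X1; field.
have rootE : (Num.sqrt (1 - 3 / 4))^-1 = 2 :> R.
  rewrite (_ : 1 - 3 / 4 = 2^-1 ^+ 2); last by field.
  by rewrite sqrtr_sqr ger0_norm// invrK.
rewrite (eq_bigr (fun=> 2%:E)) => [|j _].
  by rewrite sumEFin sumr_const card_ord mulr_natr.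
under eq_integral do rewrite mxE.
rewrite gauss_expR_sqr ?coefE ?rootE//; last by lra.
by rewrite divr_ge0// mulr_ge0// sqr_ge0.
Qed.

Lemma exp_energy_tail p (X : 'M[R]_(n, p)) : (0 < p)%N -> (forall j, sqn (col j X) = 1) ->
  (G [set x | 8 * p%:R <= exp_energy X x]%R <= 4^-1%:E)%E.
Proof.
move=> p0 X1; have p8_gt0 : 0 < 8 * p%:R :> R by rewrite mulr_gt0// ltr0n.
have := markov (P := G) (exp_energy X) p8_gt0 (@measurable_id _ _ setT) (fun _ => id)
  (fun _ _ _ _ => id).
rewrite unlock (_ : \int[G]_x _ = (2 * p%:R)%:E)%E; last first.
  rewrite -(integral_exp_energy X1); apply: eq_integral => x _ /=.
  by rewrite ger0_norm ?exp_energy_ge0.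
rewrite (_ : [set x | _] = [set x | 8 * p%:R <= exp_energy X x]%R); last first.
  by apply: eq_set => x /=; rewrite lee_fin ger0_norm ?exp_energy_ge0.
have : G [set x | 8 * p%:R <= exp_energy X x]%R \is a fin_num.
  by apply: fin_num_measure; apply: measurable_set_le => //; exact: measurable_exp_energy.
case: (G _) => // r _; rewrite -EFinM !lee_fin => le_2p.
by rewrite -(ler_pM2l p8_gt0) (le_trans le_2p)//; lra.
Qed.

Lemma sorted_correlations_le p (X : 'M[R]_(n, p)) x (j : 'I_p) :
  exp_energy X x <= 8 * p%:R ->
  sorted_abs (correlations X x) j <= 3 * lamw sigma p j.+1.
Proof.
move=> energy_le; pose r : R := 2 * p%:R / j.+1%:R.
have r2 : 2 <= r by rewrite two_le_ratio//= ltn_ord.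
have r0 : 0 < r by exact: lt_le_trans r2.
pose phi y := expR (3 / (8 * sigma ^+ 2) * y ^+ 2).
have coef0 : 0 <= 3 / (8 * sigma ^+ 2) by rewrite divr_ge0// mulr_ge0// sqr_ge0.
have phi_nd : {in Num.nneg &, {homo phi : y z / y <= z}}.
  by move=> y z y0 z0 yz; rewrite ler_expR ler_wpM2l// ler_pXn2r.
have phi_le : phi (sorted_abs (correlations X x) j) <= r ^+ 3.
  have : j.+1%:R * phi (sorted_abs (correlations X x) j) <= 8 * p%:R.
    apply: le_trans (sorted_abs_sum_ge _ _ phi_nd (fun=> expR_ge0 _)) _.
    rewrite (le_trans _ energy_le)// le_eqVlt; apply/orP; left; apply/eqP.
    by apply: eq_bigr => i _; rewrite /phi real_normK ?num_real.
  rewrite mulrC -ler_pdivlMr ?ltr0n// => /le_trans; apply.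
  rewrite (_ : 8 * p%:R / _ = r * 2 ^+ 2); last by rewrite /r; ring.
  by rewrite [r ^+ 3]exprS ler_pM2l// ler_pXn2r// nnegrE ltW.
have exponent_le : 3 / (8 * sigma ^+ 2) * sorted_abs (correlations X x) j ^+ 2 <= 3 * ln r.
  by rewrite -ler_expR expRM_natl lnK ?posrE.
have lnr0 : 0 <= sigma ^+ 2 * ln r.
  by rewrite mulr_ge0 ?sqr_ge0// ln_ge0// (le_trans _ r2)// ler1n.
have s0 := ltW sigma_gt0.
rewrite -(@ler_pXn2r _ 2)// ?nnegrE ?sorted_abs_ge0 ?mulr_ge0 ?lamw_ge0//.
rewrite exprMn sqr_lamw//= -/r.
move: exponent_le; rewrite mulrAC ler_pdivrMr ?mulr_gt0 ?exprn_gt0//; lra.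
Qed.

Lemma tdot_mulmx_le_Jsl p (X : 'M[R]_(n, p)) x : exp_energy X x <= 8 * p%:R ->
  forall u, tdot (X *m u) x <= 3 * Jsl (lamw sigma p) u.
Proof.
move=> energy_le u; rewrite tdot_mulmx (le_trans (dotv_le_sorted_abs _ _))//.
rewrite /Jsl mulr_sumr; apply: ler_sum => j _; rewrite mulrA.
by rewrite ler_wpM2r ?sorted_abs_ge0// sorted_correlations_le.
Qed.

End correlations.

Section noise_bound.
Context {R : realType}.
Variables (n p : nat) (X : 'M[R]_(n, p)) (sigma : R).
Hypotheses (sigma_gt0 : 0 < sigma) (n_gt0 : (0 < n)%N) (p_gt0 : (0 < p)%N).
Hypothesis X_unit : forall j, sqn (col j X) = 1.
Notation RR := (measurableTypeR R).
Notation G := (gauss_prob sigma n).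

Definition penalty (w : 'cV[R]_(p + n)) : R :=
  Jsl (lamw sigma p) (usubmx w) + Jsl (lamw sigma n) (dsubmx w).

Let s_ge0 : 0 <= sigma. Proof. exact: ltW. Qed.
Let lam_ge0 m j : 0 <= lamw sigma m j. Proof. exact: lamw_ge0. Qed.
Let lam_ninc m : (0 < m)%N -> forall i j, (0 < i <= j)%N -> lamw sigma m j <= lamw sigma m i.
Proof. by move=> m0 i j; exact: lamw_ninc. Qed.

Lemma penalty_ge0 w : 0 <= penalty w.
Proof. by rewrite addr_ge0 ?Jsl_ge0. Qed.

Lemma penaltyD v w : penalty (v + w) <= penalty v + penalty w.
Proof.
rewrite /penalty !linearD/=.
have := Jsl_triangle (lam_ge0 p) (lam_ninc p_gt0) (usubmx v) (usubmx w).
have := Jsl_triangle (lam_ge0 n) (lam_ninc n_gt0) (dsubmx v) (dsubmx w).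
lra.
Qed.

Lemma penalty_le_l1 w : penalty w <= (lamw sigma p 1 + lamw sigma n 1) * l1 w.
Proof.
have l1E : l1 w = l1 (usubmx w) + l1 (dsubmx w).
  by rewrite /l1 big_split_ord/=; congr (_ + _); apply: eq_bigr => i _; rewrite mxE.
rewrite mulrDl l1E; apply: lerD.
- rewrite (le_trans (Jsl_le_l1 (lam_ninc p_gt0) _))// ler_wpM2l// lerDl; exact: l1_ge0.
- rewrite (le_trans (Jsl_le_l1 (lam_ninc n_gt0) _))// ler_wpM2l// lerDr; exact: l1_ge0.
Qed.

Lemma sqn_col_1 (j : 'I_n) : sqn (col j 1%:M : 'cV[R]_n) = 1.
Proof. by rewrite col1 sqn_delta. Qed.

Lemma noise_median : exists2 A : set (n.-tuple RR), measurable A &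
  (2^-1%:E <= G A)%E /\
  forall x, A x -> forall w, tdot (row_mx X 1%:M *m w) x <= 3 * penalty w.
Proof.
pose X_large := [set x | 8 * p%:R <= exp_energy sigma X x].
pose id_large := [set x | 8 * n%:R <= exp_energy sigma (1%:M : 'M[R]_n) x].
have mX_large : measurable X_large.
  by apply: measurable_set_le => //; exact: measurable_exp_energy.
have mid_large : measurable id_large.
  by apply: measurable_set_le => //; exact: measurable_exp_energy.
have mlarge : measurable (X_large `|` id_large) by exact: measurableU.
exists (~` (X_large `|` id_large)); first exact: measurableC.
split.
  have GA : (G (X_large `|` id_large) <= 4^-1%:E + 4^-1%:E)%E.
    apply: (le_trans (measureU2 _ mX_large mid_large)).
    by apply: leeD; apply: exp_energy_tail => //; exact: sqn_col_1.
  have : G (X_large `|` id_large) \is a fin_num by exact: fin_num_measure.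
  rewrite probability_setC//; case: (G (X_large `|` id_large)) GA => // r.
  by rewrite -EFinD -EFinB !lee_fin => GA _; lra.
move=> x /= /not_orP[/negP + /negP +] w; rewrite -!ltNge => /ltW energy_X_le /ltW energy_id_le.
rewrite -[w]vsubmxK mul_row_col mul1mx tdotD /penalty col_mxKu col_mxKd mulrDr lerD//.
  exact: tdot_mulmx_le_Jsl.
by have := tdot_mulmx_le_Jsl sigma_gt0 energy_id_le (dsubmx w); rewrite mul1mx.
Qed.

Lemma noise_bound (tau : R) : 0 < tau -> exists2 E : set (n.-tuple RR), measurable E &
  ((1 - 4 * expR (- (tau ^+ 2 / (2304 * sigma ^+ 2))))%:E <= G E)%E /\
  forall x, E x -> forall w,
    tdot (row_mx X 1%:M *m w) x <= 32 / 5 * penalty w + tau * l2 (row_mx X 1%:M *m w).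
Proof.
move=> tau0; have [A mA [GA A_le]] := noise_median.
have half_gt0 : 0 < 2^-1 :> R by rewrite invr_gt0.
have beta_gt0 : 0 < 16^-1 :> R by rewrite invr_gt0.
have beta_lt1 : 16^-1 < 1 :> R by rewrite invf_lt1// ltr1n.
have [] := sublinear_concentration (M := row_mx X 1%:M) (N := fun w => 3 * penalty w)
  (C := 3 * (lamw sigma p 1 + lamw sigma n 1)) (lt0r_neq0 sigma_gt0) half_gt0 tau0
  beta_gt0 beta_lt1 _ _ _ mA GA A_le.
- by rewrite mulr_ge0// addr_ge0.
- by move=> w; rewrite mulr_ge0 ?penalty_ge0//= -mulrA ler_pM2l// penalty_le_l1.
- by move=> v w; rewrite -mulrDr ler_pM2l// penaltyD.
move=> E mE [GE E_le]; exists E => //; split.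
  apply: le_trans GE; rewrite lee_fin lerD2l lerN2 /concentration_tail.
  rewrite [2^-1 ^+ 2]exprVn invrK [leLHS]mulrC -natrX ler_pM2l// ler_expR lerN2.
  rewrite le_eqVlt; apply/orP; left; apply/eqP.
  by field; rewrite lt0r_neq0.
move=> x Ex w; apply: (le_trans (E_le x Ex w)); rewrite lerD2r mulrA.
by rewrite (_ : _ * 3 = 32 / 5) //; field.
Qed.

End noise_bound.

Section noise_law.
Context {R : realType} {d : measure_display} {T : measurableType d}.
Variables (P : probability T R) (n : nat) (eps : 'I_n -> T -> R) (sigma : R).
Hypothesis measurable_eps : forall i, measurable_fun setT (eps i).
Hypothesis eps_law : forall i (A : set R), measurable A ->
  P (eps i @^-1` A) = normal_prob 0 sigma A.
Hypothesis eps_indep : indep_rvs P eps.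
Notation RR := (measurableTypeR R).

Definition noise_tuple (w : T) : n.-tuple RR := [tuple (eps i w : RR) | i < n].

Lemma measurable_noise_tuple : measurable_fun setT noise_tuple.
Proof.
apply/measurable_fun_tnthP => i /=.
rewrite (_ : _ \o _ = eps i); first exact: measurable_eps.
by apply/funext => w /=; rewrite tnth_mktuple.
Qed.

HB.instance Definition _ :=
  isMeasurableFun.Build _ _ _ _ noise_tuple measurable_noise_tuple.

Lemma noise_tuple_law B : measurable B -> P (noise_tuple @^-1` B) = gauss_prob sigma n B.
Proof.
apply: (eq_probability_tuple (P := distribution P noise_tuple)) => A mA.
rewrite iid_prob_box//.
have boxE : noise_tuple @^-1` [set t | forall i, A i (tnth t i)] =
    \bigcap_(i in [set: 'I_n]) (eps i @^-1` A i).
  apply/seteqP; split => w /=; first by move=> wA i _; have := wA i; rewrite tnth_mktuple.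
  by move=> wA i; rewrite tnth_mktuple; exact: wA.
transitivity (P (\bigcap_(i in [set: 'I_n]) (eps i @^-1` A i))); first by rewrite -boxE.
rewrite eps_indep; last by move=> i; exact: mA.
by apply: eq_bigr => i _; exact: (eps_law i (mA i)).
Qed.

Lemma noise_event p (X : 'M[R]_(n, p)) (tau : R) : 0 < sigma -> 0 < tau ->
  (0 < n)%N -> (0 < p)%N -> (forall j, sqn (col j X) = 1) ->
  exists2 E : set T, measurable E &
    ((1 - 4 * expR (- (tau ^+ 2 / (2304 * sigma ^+ 2))))%:E <= P E)%E /\
    forall w, E w -> forall (u : 'cV[R]_p) (v : 'cV[R]_n),
      dotv (X *m u + v) (\col_i eps i w) <=
      32 / 5 * (Jsl (lamw sigma p) u + Jsl (lamw sigma n) v) + tau * l2 (X *m u + v).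
Proof.
move=> sigma0 tau0 n0 p0 X1.
have [E mE [GE E_le]] := noise_bound sigma0 n0 p0 X1 tau0.
exists (noise_tuple @^-1` E).
  by rewrite -[X in measurable X]setTI; exact: (measurable_noise_tuple measurableT mE).
split; first by rewrite noise_tuple_law.
move=> w Ew u v; have := E_le _ Ew (col_mx u v).
rewrite mul_row_col mul1mx /penalty col_mxKu col_mxKd; apply: le_trans.
by apply: ler_sum => i _; rewrite mxE tnth_mktuple.
Qed.

End noise_law.

(** * Deterministic error bounds *)

Lemma ge0_of_segment {R : realFieldType} (a b : R) :
  (forall t, 0 < t <= 1 -> 0 <= a + t * b) -> 0 <= a.
Proof.
move=> ab; rewrite leNgt; apply/negP => a0.
have [b0|b0] := leP b 0; first by have := ab 1; rewrite ltr01 lexx mul1r => /(_ isT); lra.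
have ba0 : 0 < b - a by lra.
have t01 : 0 < - a / (b - a) <= 1.
  by rewrite divr_gt0 ?oppr_gt0//= ler_pdivrMr// mul1r; lra.
have := ab _ t01; rewrite -(pmulr_lge0 _ ba0) leNgt => /negP; apply.
rewrite (_ : (a + - a / (b - a) * b) * (b - a) = - a ^+ 2); last by field; rewrite gt_eqF.
by rewrite oppr_lt0 exprn_even_gt0//= lt_eqF.
Qed.

Section slope_basic_inequality.
Context {R : realType}.
Variables (n p : nat) (X : 'M[R]_(n, p)) (lamt lam : nat -> R) (rho : R).
Hypothesis rho_ge0 : 0 <= rho.
Hypotheses (lamt_ge0 : forall j, 0 <= lamt j) (lam_ge0 : forall j, 0 <= lam j).
Hypothesis lamt_ninc : forall i j, (0 < i <= j)%N -> lamt j <= lamt i.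
Hypothesis lam_ninc : forall i j, (0 < i <= j)%N -> lam j <= lam i.

Definition slope_objective (y : 'cV[R]_n) (b : 'cV[R]_p) (m : 'cV[R]_n) : R :=
  sqn (y - X *m b - m) + 2 * rho * Jsl lamt b + 2 * rho * Jsl lam m.

Definition slope_error (b b' : 'cV[R]_p) (m m' : 'cV[R]_n) : 'cV[R]_n :=
  X *m (b - b') + (m - m').

Lemma slope_objective_segment_le (y : 'cV[R]_n) (b b' : 'cV[R]_p) (m m' : 'cV[R]_n) t :
  0 <= t <= 1 ->
  slope_objective y (b + t *: (b' - b)) (m + t *: (m' - m)) <=
  slope_objective y b m + t * (2 * dotv (y - X *m b - m) (slope_error b b' m m') +
    t * sqn (slope_error b b' m m') +
    2 * rho * (Jsl lamt b' - Jsl lamt b + (Jsl lam m' - Jsl lam m))).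
Proof.
move=> t01; set r := y - _ - m; set d := slope_error _ _ _ _.
have rE : y - X *m (b + t *: (b' - b)) - (m + t *: (m' - m)) = r + t *: d.
  rewrite /r /d /slope_error mulmxDr -scalemxAr !mulmxBr.
  by apply/colP => i; rewrite !mxE; ring.
rewrite /slope_objective rE -/r sqnD dotvZr sqnZ.
have := ler_wpM2l rho_ge0 (Jsl_convex lamt_ge0 lamt_ninc b b' t01).
have := ler_wpM2l rho_ge0 (Jsl_convex lam_ge0 lam_ninc m m' t01).
lra.
Qed.

(* First-order optimality along the segment to the truth; this gains a factor
   2 over merely comparing the objective at its two ends. *)
Lemma slope_basic_inequality (b bh : 'cV[R]_p) (m mh e : 'cV[R]_n) :
  (forall b' m', slope_objective (X *m b + m + e) bh mh <=
                 slope_objective (X *m b + m + e) b' m') ->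
  sqn (slope_error bh b mh m) <= dotv (slope_error bh b mh m) e +
    rho * (Jsl lamt b - Jsl lamt bh + (Jsl lam m - Jsl lam mh)).
Proof.
move=> opt; set d := slope_error _ _ _ _; set D := _ + (_ - _).
have rE : X *m b + m + e - X *m bh - mh = e + (- 1) *: d.
  by rewrite /d /slope_error mulmxBr; apply/colP => i; rewrite !mxE; ring.
have rd : dotv (e + (- 1) *: d) d = dotv d e - sqn d.
  by rewrite dotvDl dotvC (dotvC _ d) dotvZr dotvv; ring.
suff : 0 <= 2 * dotv (e + (- 1) *: d) d + 2 * rho * D by rewrite rd; lra.
apply: (ge0_of_segment (b := sqn d)) => t /andP[t0 t1].
have t01 : 0 <= t <= 1 by rewrite ltW.
have := le_trans (opt _ _) (slope_objective_segment_le _ bh b mh m t01).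
by rewrite rE -/d -/D lerDl pmulr_rge0// addrAC.
Qed.

End slope_basic_inequality.

Section slope_rates.
Context {R : realFieldType}.
Variables (K c tau D nu nv A B : R).
Hypotheses (tau_gt0 : 0 < tau) (A_ge0 : 0 <= A).
Hypotheses (nu_ge0 : 0 <= nu) (nv_ge0 : 0 <= nv) (c_ge0 : 0 <= c).
Hypotheses (tauA : tau <= c * A) (tauB : tau <= c * B).

Let sqr_tau_le : tau ^+ 2 <= c ^+ 2 * (A ^+ 2 + B ^+ 2).
Proof.
have : tau ^+ 2 <= (c * A) ^+ 2 by rewrite ler_pXn2r ?nnegrE ?mulr_ge0// (ltW tau_gt0).
by have := sqr_ge0 (c * B); rewrite !exprMn; lra.
Qed.

Lemma rate_on_cone (rho : R) : 0 < K <= 1 ->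
  K * (nu ^+ 2 + nv ^+ 2) <= D ^+ 2 ->
  D ^+ 2 <= tau * D + 2 * rho * (A * nu + B * nv) ->
  nu ^+ 2 + nv ^+ 2 <= (2 * c ^+ 2 + 8 * rho ^+ 2) / K ^+ 2 * (A ^+ 2 + B ^+ 2).
Proof.
move=> /andP[K0 K1] KD DD; have tau2 := sqr_tau_le.
set e := nu ^+ 2 + nv ^+ 2 in KD *; set L := A ^+ 2 + B ^+ 2 in tau2 *.
have young_tau : tau * D <= D ^+ 2 / 4 + tau ^+ 2.
  by have := sqr_ge0 (D / 2 - tau); rewrite sqrrB; lra.
have young a x : K * (2 * rho * (a * x)) <= 4 * rho ^+ 2 * a ^+ 2 + K ^+ 2 * x ^+ 2 / 4.
  by have := sqr_ge0 (2 * rho * a - K * x / 2); rewrite sqrrB; lra.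
have cL : K * (c ^+ 2 * L) <= c ^+ 2 * L.
  by rewrite ler_piMl// mulr_ge0 ?addr_ge0 ?sqr_ge0.
have KKD : K ^+ 2 * e <= K * D ^+ 2 by rewrite expr2 -mulrA ler_pM2l.
have KD_le : K * D ^+ 2 <= K * (D ^+ 2 / 4 + tau ^+ 2 + 2 * rho * (A * nu) + 2 * rho * (B * nv)).
  by rewrite ler_pM2l//; move: DD young_tau; lra.
have Ktau : K * tau ^+ 2 <= K * (c ^+ 2 * L) by rewrite ler_pM2l.
rewrite mulrAC ler_pdivlMr ?exprn_gt0//.
move: KKD KD_le Ktau cL (young A nu) (young B nv); rewrite /e /L; lra.
Qed.

(* Off the cone the penalty is at most of order tau^2. *)
Lemma rate_off_cone (eta l S : R) : 0 < eta -> 0 < l ->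
  l * (A * nu + B * nv) <= S -> D ^+ 2 <= tau * D - eta * S ->
  nu ^+ 2 + nv ^+ 2 <= (c ^+ 2 / (4 * l * eta)) ^+ 2 * (A ^+ 2 + B ^+ 2).
Proof.
move=> eta0 l0 S_ge D_le.
have penalty_le : eta * S <= tau ^+ 2 / 4.
  by have := sqr_ge0 (D - tau / 2); rewrite sqrrB; lra.
have weighted_le : tau * (nu + nv) <= c * (A * nu + B * nv).
  by have := ler_wpM2r nu_ge0 tauA; have := ler_wpM2r nv_ge0 tauB; lra.
have sum_le : nu + nv <= c / (4 * l * eta) * tau.
  rewrite -(ler_pM2l tau_gt0) mulrAC mulrA ler_pdivlMr ?mulr_gt0//.
  have := ler_wpM2r (mulr_ge0 (ltW l0) (ltW eta0)) weighted_le.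
  have := ler_wpM2l (mulr_ge0 c_ge0 (ltW eta0)) S_ge; have := ler_wpM2l c_ge0 penalty_le; lra.
have coef0 : 0 <= c / (4 * l * eta) by rewrite divr_ge0 ?mulr_ge0// ltW.
have sqr_sum_le : (nu + nv) ^+ 2 <= (c / (4 * l * eta)) ^+ 2 * tau ^+ 2.
  by rewrite -exprMn ler_pXn2r ?nnegrE ?addr_ge0 ?(mulr_ge0 coef0 (ltW tau_gt0)).
apply: (@le_trans _ _ ((nu + nv) ^+ 2)).
  by have := mulr_ge0 nu_ge0 nv_ge0; rewrite sqrrD; lra.
apply: (le_trans sqr_sum_le).
rewrite (_ : c ^+ 2 / (4 * l * eta) = c / (4 * l * eta) * c); last by rewrite expr2 mulrAC.
by rewrite [in leRHS]exprMn -[leRHS]mulrA ler_wpM2l ?sqr_ge0.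
Qed.

End slope_rates.

Section restricted_eigenvalue.
Context {R : realType}.
Variables (n p : nat) (X : 'M[R]_(n, p)).

Definition restricted_eigen (lamt lam : nat -> R) (a b kappa1 kappa2 : R) : Prop :=
  forall (u : 'cV[R]_p) (v : 'cV[R]_n),
    Jsl lamt u + Jsl lam v <= 5 * (a * l2 u + b * l2 v) ->
    sqn (X *m u) + sqn v >= kappa1 * (sqn u + sqn v) /\
    `|dotv (X *m u) v| <= kappa2 * (sqn u + sqn v).

Lemma restricted_eigen_gap lamt lam a b kappa1 kappa2 u v :
  restricted_eigen lamt lam a b kappa1 kappa2 ->
  Jsl lamt u + Jsl lam v <= 5 * (a * l2 u + b * l2 v) ->
  (kappa1 - 2 * kappa2) * (sqn u + sqn v) <= sqn (X *m u + v).
Proof.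
move=> re /re[norm_ge dot_le]; rewrite sqnD; move: dot_le.
by rewrite ler_norml => /andP[dot_ge _]; lra.
Qed.

Variables (sigma kappa1 kappa2 : R) (k s : nat).
Hypotheses (sigma_gt0 : 0 < sigma) (k_gt0 : (0 < k)%N) (kp : (k <= p)%N).
Hypotheses (s_gt0 : (0 < s)%N) (sn : (s <= n)%N).

Let p_gt0 : (0 < p)%N. Proof. exact: leq_trans kp. Qed.
Let n_gt0 : (0 < n)%N. Proof. exact: leq_trans sn. Qed.
Let s_ge0 : 0 <= sigma. Proof. exact: ltW. Qed.

Lemma JslZ m (lam : nat -> R) (a : R) (u : 'cV[R]_m) :
  Jsl (fun j => lam j / a) u = Jsl lam u / a.
Proof. by rewrite /Jsl mulr_suml; apply: eq_bigr => j _; rewrite mulrAC. Qed.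

Lemma head_norm_le_normalized q m : (0 < q <= m)%N ->
  head_norm sigma m q <= sigma * Num.sqrt (ln 2) * Num.sqrt (log_ratio_e m q / ln 2).
Proof.
move=> /andP[q0 qm]; have ln2 : 0 < ln 2 :> R by rewrite ln_gt0// ltr1n.
have ratio0 : 0 <= log_ratio_e m q :> R.
  rewrite -(pmulr_rge0 _ (exprn_gt0 2 sigma_gt0)).
  by rewrite (le_trans _ (sqr_head_norm_le sigma q0 qm))// sqr_ge0.
rewrite -mulrA -sqrtrM ?(ltW ln2)// mulrCA divff ?gt_eqF// mulr1.
rewrite -(@ler_pXn2r _ 2)// ?nnegrE ?head_norm_ge0 ?mulr_ge0 ?sqrtr_ge0//.
by rewrite exprMn [X in _ * X]sqr_sqrtr// sqr_head_norm_le.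
Qed.

Lemma restricted_eigen_head :
  restricted_eigen (fun j => lamw sigma p j / lamw sigma p p)
    (fun j => lamw sigma n j / lamw sigma n n)
    (Num.sqrt (log_ratio_e p k / ln 2)) (Num.sqrt (log_ratio_e n s / ln 2))
    kappa1 kappa2 ->
  restricted_eigen (lamw sigma p) (lamw sigma n) (head_norm sigma p k)
    (head_norm sigma n s) kappa1 kappa2.
Proof.
move=> re u v cone; apply: re; rewrite !JslZ !lamw_last// -mulrDl.
have ln2 : 0 < ln 2 :> R by rewrite ln_gt0// ltr1n.
rewrite ler_pdivrMr ?mulr_gt0 ?sqrtr_gt0//; apply: (le_trans cone).
have coef_le := ler_wpM2r (l2_ge0 u) (head_norm_le_normalized (introT andP (conj k_gt0 kp))).
have shift_le := ler_wpM2r (l2_ge0 v) (head_norm_le_normalized (introT andP (conj s_gt0 sn))).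
by move: coef_le shift_le; lra.
Qed.

Lemma restricted_eigen_le1 :
  restricted_eigen (lamw sigma p) (lamw sigma n) (head_norm sigma p k)
    (head_norm sigma n s) kappa1 kappa2 -> kappa1 <= 1.
Proof.
move=> re; pose e1 : 'cV[R]_n := delta_mx (Ordinal n_gt0) 0.
have lam_ninc m : (0 < m)%N -> forall i j, (0 < i <= j)%N -> lamw sigma m j <= lamw sigma m i.
  by move=> m0 i j; exact: lamw_ninc.
have [] := re 0 e1; last by rewrite mulmx0 !sqn0 sqn_delta !add0r mulr1.
have := Jsl_le_l1 (lam_ninc p p_gt0) (0 : 'cV[R]_p); have := Jsl_le_l1 (lam_ninc n n_gt0) e1.
have := lamw_first_le_head_norm n s_gt0 s_ge0; have := head_norm_ge0 sigma n s.
by rewrite l1_0 l1_delta l2_0 l2_delta; lra.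
Qed.

End restricted_eigenvalue.

Section noise_level.
Context {R : realType}.
Variables (sigma : R) (n p k s : nat).
Hypotheses (sigma_gt0 : 0 < sigma) (k_gt0 : (0 < k)%N) (kp : (k <= p)%N).
Hypotheses (s_gt0 : (0 < s)%N) (sn : (s <= n)%N).

Let ell : R := Num.min (log_ratio p k) (log_ratio n s).

Definition noise_level : R := 96 * sigma * Num.sqrt ell.

Let ell_ge : ln 2 <= ell. Proof. by rewrite le_min !log_ratio_ge. Qed.

Let ell_gt0 : 0 < ell.
Proof. by apply: lt_le_trans ell_ge; rewrite ln_gt0// ltr1n. Qed.

Lemma noise_level_gt0 : 0 < noise_level.
Proof. by rewrite !mulr_gt0// sqrtr_gt0. Qed.

Lemma sqr_noise_level : noise_level ^+ 2 = 96 ^+ 2 * (sigma ^+ 2 * ell).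
Proof. by rewrite !exprMn sqr_sqrtr ?ltW// mulrA. Qed.

Let noise_level_le_head q m : (0 < q <= m)%N -> ell <= log_ratio m q ->
  noise_level <= 96 * head_norm sigma m q.
Proof.
move=> /andP[q0 qm] ell_le.
rewrite -(@ler_pXn2r _ 2) ?nnegrE ?(ltW noise_level_gt0) ?mulr_ge0 ?head_norm_ge0//.
rewrite sqr_noise_level exprMn ler_wpM2l ?sqr_ge0//.
by rewrite (le_trans _ (sqr_head_norm_ge sigma q0 qm))// ler_wpM2l ?sqr_ge0.
Qed.

Lemma noise_level_le_coef : noise_level <= 96 * head_norm sigma p k.
Proof. by apply: noise_level_le_head; rewrite ?k_gt0// ge_min lexx. Qed.

Lemma noise_level_le_shift : noise_level <= 96 * head_norm sigma n s.
Proof. by apply: noise_level_le_head; rewrite ?s_gt0// ge_min lexx orbT. Qed.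

Lemma noise_level_tail :
  1 - 2^-1 * (s%:R / (2 * n%:R)) ^+ s - 2^-1 * (k%:R / (2 * p%:R)) ^+ k <=
  1 - 4 * expR (- (noise_level ^+ 2 / (2304 * sigma ^+ 2))).
Proof.
have -> : noise_level ^+ 2 / (2304 * sigma ^+ 2) = 3 * ell + ell.
  by rewrite sqr_noise_level; field; rewrite gt_eqF.
have small : expR (- (3 * ell)) <= 8^-1.
  apply: (@le_trans _ _ (expR (- (3 * ln 2)))).
    by rewrite ler_expR lerN2 ler_pM2l.
  by rewrite expRN expRM_natl lnK ?posrE// -natrX.
have ell_tail : expR (- ell) <= (s%:R / (2 * n%:R)) ^+ s + (k%:R / (2 * p%:R)) ^+ k.
  rewrite -!expRN_log_ratio// /ell minEle; case: ifP => _.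
    by rewrite lerDr expR_ge0.
  by rewrite lerDl expR_ge0.
by rewrite opprD expRD; have := ler_wpM2r (expR_ge0 (- ell)) small; lra.
Qed.

End noise_level.

Definition slope_constant {R : realType} (rho : R) : R :=
  2 * 96 ^+ 2 + 8 * rho ^+ 2 + (96 ^+ 2 / (4 * 5 * ((3 * rho - 32) / 5))) ^+ 2.

Lemma slope_constant_gt0 {R : realType} (rho : R) : 0 < slope_constant rho.
Proof.
apply: ltr_wpDr; first exact: sqr_ge0.
by apply: ltr_wpDr; [exact/mulr_ge0/sqr_ge0|exact/mulr_gt0/exprn_gt0].
Qed.

Lemma rho_gt_32_3 {R : realType} (rho : R) : 2 * (4 + Num.sqrt 2) <= rho -> 32 / 3 < rho.
Proof.
have : 4 / 3 < Num.sqrt 2 :> R.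
  by rewrite -(@ltr_pXn2r _ 2)// ?nnegrE ?sqrtr_ge0 ?divr_ge0// sqr_sqrtr//; lra.
by lra.
Qed.

Section slope_error_bound.
Context {R : realType}.
Variables (n p k s : nat) (X : 'M[R]_(n, p)) (sigma rho kappa1 kappa2 : R).
Variables (b bh : 'cV[R]_p) (m mh e : 'cV[R]_n).
Hypotheses (sigma_gt0 : 0 < sigma) (k_gt0 : (0 < k)%N) (kp : (k <= p)%N).
Hypotheses (s_gt0 : (0 < s)%N) (sn : (s <= n)%N).
Hypotheses (b_sparse : (l0 b <= k)%N) (m_sparse : (l0 m <= s)%N).
Hypothesis rho_gt : 32 / 3 < rho.
Hypothesis kappa_lt : 0 < 2 * kappa2 < kappa1.
Notation lamt := (lamw sigma p).
Notation lam := (lamw sigma n).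
Notation tau := (noise_level sigma n p k s).
Notation A := (head_norm sigma p k).
Notation B := (head_norm sigma n s).
Notation K := (kappa1 - 2 * kappa2).
Hypothesis re : restricted_eigen X lamt lam A B kappa1 kappa2.
Hypothesis noise_le : forall (u : 'cV[R]_p) (v : 'cV[R]_n),
  dotv (X *m u + v) e <= 32 / 5 * (Jsl lamt u + Jsl lam v) + tau * l2 (X *m u + v).
Hypothesis bh_mh_optimal : forall b' m',
  slope_objective X lamt lam rho (X *m b + m + e) bh mh <=
  slope_objective X lamt lam rho (X *m b + m + e) b' m'.

Let u := bh - b.
Let v := mh - m.
Let D := l2 (X *m u + v).
Let S := Jsl lamt u + Jsl lam v.

Let s_ge0 : 0 <= sigma. Proof. exact: ltW. Qed.
Let rho_ge0 : 0 <= rho. Proof. by move: rho_gt; lra. Qed.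
Let lam_ge0 q j : 0 <= lamw sigma q j. Proof. exact: lamw_ge0. Qed.
Let lam_ninc q : (0 < q)%N -> forall i j, (0 < i <= j)%N -> lamw sigma q j <= lamw sigma q i.
Proof. by move=> q0 i j; exact: lamw_ninc. Qed.

Let Jsl_sparse_le q l (x xh : 'cV[R]_q) : (0 < q)%N -> (l0 x <= l)%N -> (l <= q)%N ->
  Jsl (lamw sigma q) x + Jsl (lamw sigma q) (xh - x) - Jsl (lamw sigma q) xh <=
  2 * (head_norm sigma q l * l2 (xh - x)).
Proof.
move=> q0 xl lq.
have := Jsl_decomposable (lam_ge0 q) (lam_ninc q0) (xh - x) (introT andP (conj xl lq)).
rewrite (addrC x) subrK => /le_trans; apply.
by rewrite ler_pM2l// head_le_l2.
Qed.

Lemma slope_prediction_le :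
  D ^+ 2 <= tau * D + 2 * rho * (A * l2 u + B * l2 v) - (rho - 32 / 5) * S.
Proof.
have p0 : (0 < p)%N by exact: leq_trans kp.
have n0 : (0 < n)%N by exact: leq_trans sn.
have basic := slope_basic_inequality rho_ge0 (lam_ge0 p) (lam_ge0 n) (lam_ninc p0) (lam_ninc n0)
  bh_mh_optimal.
have coef := ler_wpM2l rho_ge0 (Jsl_sparse_le bh p0 b_sparse kp).
have shift := ler_wpM2l rho_ge0 (Jsl_sparse_le mh n0 m_sparse sn).
have := noise_le u v; rewrite -/D -/S.
move: basic coef shift; rewrite /slope_error -/u -/v -(sqr_l2 (X *m u + v)) -/D /S; lra.
Qed.

Let tau_gt0 : 0 < tau. Proof. exact: noise_level_gt0. Qed.
Let tauA : tau <= 96 * A. Proof. exact: noise_level_le_coef. Qed.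
Let tauB : tau <= 96 * B. Proof. exact: noise_level_le_shift. Qed.

Lemma slope_error_on_cone : S <= 5 * (A * l2 u + B * l2 v) ->
  sqn u + sqn v <= (2 * 96 ^+ 2 + 8 * rho ^+ 2) / K ^+ 2 * (A ^+ 2 + B ^+ 2).
Proof.
move=> cone; have /andP[kappa2_gt0 kappa2_lt] := kappa_lt.
have K01 : 0 < K <= 1.
  by rewrite subr_gt0 kappa2_lt; have := restricted_eigen_le1 sigma_gt0 k_gt0 kp s_gt0 sn re; lra.
have gap := restricted_eigen_gap re cone.
have S0 : 0 <= S by rewrite addr_ge0 ?Jsl_ge0.
have predict : D ^+ 2 <= tau * D + 2 * rho * (A * l2 u + B * l2 v).
  have : 0 <= (rho - 32 / 5) * S by rewrite mulr_ge0//; move: rho_gt; lra.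
  by have := slope_prediction_le; lra.
rewrite -!sqr_l2; apply: (rate_on_cone tau_gt0 _ _ tauA K01 _ predict).
- exact: head_norm_ge0.
- by rewrite ler0n.
- by rewrite !sqr_l2.
Qed.

Lemma slope_error_off_cone : 5 * (A * l2 u + B * l2 v) <= S ->
  sqn u + sqn v <= (96 ^+ 2 / (4 * 5 * ((3 * rho - 32) / 5))) ^+ 2 * (A ^+ 2 + B ^+ 2).
Proof.
move=> cone; have eta0 : 0 < (3 * rho - 32) / 5 by move: rho_gt; lra.
have predict : D ^+ 2 <= tau * D - (3 * rho - 32) / 5 * S.
  by have := slope_prediction_le; have := ler_wpM2l rho_ge0 cone; lra.
rewrite -!sqr_l2; apply: (rate_off_cone tau_gt0 _ _ _ _ tauA tauB eta0 _ cone predict) => //.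
- exact: head_norm_ge0.
- exact: l2_ge0.
- exact: l2_ge0.
Qed.

Lemma slope_error_bound :
  sqn u + sqn v <= slope_constant rho / K ^+ 2 * (A ^+ 2 + B ^+ 2).
Proof.
have /andP[kappa2_gt0 kappa2_lt] := kappa_lt.
have K0 : 0 < K by rewrite subr_gt0.
have K1 : K <= 1 by have := restricted_eigen_le1 sigma_gt0 k_gt0 kp s_gt0 sn re; lra.
have L0 : 0 <= A ^+ 2 + B ^+ 2 by rewrite addr_ge0 ?sqr_ge0.
have [cone|/ltW cone] := leP S (5 * (A * l2 u + B * l2 v)).
  apply: le_trans (slope_error_on_cone cone) _.
  by rewrite ler_wpM2r// ler_wpM2r ?invr_ge0 ?sqr_ge0// lerDl sqr_ge0.
apply: le_trans (slope_error_off_cone cone) _; rewrite ler_wpM2r//.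
apply: (@le_trans _ _ (slope_constant rho)).
  by rewrite lerDr addr_ge0// mulr_ge0// sqr_ge0.
rewrite ler_pdivlMr ?exprn_gt0// ler_piMr ?(ltW (slope_constant_gt0 rho))//.
by rewrite exprn_ile1// ltW.
Qed.

End slope_error_bound.

Lemma slope_rate_le {R : realType} (C K sigma : R) (n p k s : nat) : 0 <= C ->
  (0 < k)%N -> (k <= p)%N -> (0 < s)%N -> (s <= n)%N ->
  C / K ^+ 2 * (head_norm sigma p k ^+ 2 + head_norm sigma n s ^+ 2) <=
  C * sigma ^+ 2 / K ^+ 2 * (log_ratio_e p k + log_ratio_e n s).
Proof.
move=> C0 k0 kp s0 sn; rewrite [C * _ / _]mulrAC -[leRHS]mulrA.
rewrite ler_wpM2l ?divr_ge0 ?sqr_ge0// mulrDr.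
by rewrite lerD ?sqr_head_norm_le.
Qed.

Theorem theorem4 (R : realType) (rho : R) (hrho : 2 * (4 + Num.sqrt 2) <= rho) :
  exists C' : R, 0 < C' /\
  forall (n p k s : nat) (X : 'M[R]_(n, p)) (sigma : R)
    (betas : 'cV[R]_p) (mus : 'cV[R]_n) (kappa1 kappa2 : R)
    (d : measure_display) (T : measurableType d) (P : probability T R)
    (eps : 'I_n -> T -> R),
  (0 < k)%N -> (k <= p)%N -> (0 < s)%N -> (s <= n)%N ->
  0 < sigma ->
  (forall j : 'I_p, \sum_(i < n) X i j ^+ 2 = 1) ->
  (l0 betas <= k)%N -> (l0 mus <= s)%N ->
  (* noise: eps ~ N(0, sigma^2 I_n) *)
  (forall i, measurable_fun setT (eps i)) ->
  (forall i (A : set R), measurable A ->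
     P (eps i @^-1` A) = normal_prob 0 sigma A) ->
  indep_rvs P eps ->
  (* restricted eigenvalue-type condition *)
  0 < 2 * kappa2 < kappa1 ->
  (let lam := lamw sigma n in
   let lamt := lamw sigma p in
   let k1 := k%:R * ln (2 * expR 1 * p%:R / k%:R) / ln 2 in
   let s1 := s%:R * ln (2 * expR 1 * n%:R / s%:R) / ln 2 in
   forall (b : 'cV[R]_p) (m : 'cV[R]_n),
     Jsl (fun j => lamt j / lamt p) b + Jsl (fun j => lam j / lam n) m
       <= 5 * (Num.sqrt k1 * l2 b + Num.sqrt s1 * l2 m) ->
     sqn (X *m b) + sqn m >= kappa1 * (sqn b + sqn m) /\
     `|dotv (X *m b) m| <= kappa2 * (sqn b + sqn m)) ->
  let lam := lamw sigma n in
  let lamt := lamw sigma p in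
  let kappa := Num.sqrt (kappa1 - 2 * kappa2) in
  let y := fun w => X *m betas + mus + \col_i eps i w in
  let obj := fun w (b : 'cV[R]_p) (m : 'cV[R]_n) =>
    sqn (y w - X *m b - m) + 2 * rho * Jsl lamt b + 2 * rho * Jsl lam m in
  exists E : set T, measurable E /\
    (P E >= (1 - 2^-1 * (s%:R / (2 * n%:R)) ^+ s
                - 2^-1 * (k%:R / (2 * p%:R)) ^+ k)%:E)%E /\
    forall w, E w ->
      forall (bh : 'cV[R]_p) (mh : 'cV[R]_n),
        (forall b m, obj w bh mh <= obj w b m) ->
        sqn (bh - betas) + sqn (mh - mus)
          <= C' / kappa ^+ 4 *
             (\sum_(j < k) lamt j.+1 ^+ 2 + \sum_(j < s) lam j.+1 ^+ 2)
        /\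
        C' / kappa ^+ 4 *
             (\sum_(j < k) lamt j.+1 ^+ 2 + \sum_(j < s) lam j.+1 ^+ 2)
          <= C' * sigma ^+ 2 / kappa ^+ 4 *
             (k%:R * ln (2 * expR 1 * p%:R / k%:R)
              + s%:R * ln (2 * expR 1 * n%:R / s%:R)).
Proof.
exists (slope_constant rho); split; first exact: slope_constant_gt0.
move=> n p k s X sigma betas mus kappa1 kappa2 d T P eps k0 kp s0 sn sigma0 X1.
move=> betas_sparse mus_sparse meps law indep kappa_lt re lam lamt kappa y obj.
have p0 : (0 < p)%N by exact: leq_trans kp.
have n0 : (0 < n)%N by exact: leq_trans sn.
have X_unit j : sqn (col j X) = 1 by rewrite -(X1 j); apply: eq_bigr => i _; rewrite mxE.
have kappa4 : kappa ^+ 4 = (kappa1 - 2 * kappa2) ^+ 2.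
  by rewrite (exprM _ 2 2) sqr_sqrtr// subr_ge0 ltW//; case/andP: kappa_lt.
have tau0 := noise_level_gt0 sigma0 k0 kp s0 sn.
have [E mE [PE noise_le]] := noise_event meps law indep sigma0 tau0 n0 p0 X_unit.
exists E; split=> //; split.
  by apply: le_trans PE; rewrite lee_fin; exact: noise_level_tail.
move=> w Ew bh mh opt; rewrite kappa4 -!sqr_head_norm; split.
  exact: (slope_error_bound sigma0 k0 kp s0 sn betas_sparse mus_sparse (rho_gt_32_3 hrho)
    kappa_lt (restricted_eigen_head sigma0 k0 kp s0 sn re) (noise_le w Ew) opt).
by apply: slope_rate_le => //; exact/ltW/slope_constant_gt0.
Qed.
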